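(* Assume that for every real number $\alpha$ of bounded type the map $\Gamma_\alpha:\mathbb{R}/2\pi\mathbb{Z}\to\mathbb{C}^2$ defined in the context is of class $C^1$. Then, for every $\alpha$ of bounded type, the map $\theta\mapsto\Gamma_\alpha(\theta)$ is an embedding (an injective $C^1$ immersion of the circle into $\mathbb{C}^2$), and hence it is a conjugacy between the rotation $\theta\mapsto\theta+2\pi\alpha$ on $\mathbb{R}/2\pi\mathbb{Z}$ and the dynamics $T$ (defined in the context) restricted to the image curve $\Gamma_\alpha(\mathbb{R}/2\pi\mathbb{Z})$; that is, $\Gamma_\alpha$ is a homeomorphism onto its image and $T(\Gamma_\alpha(\theta))=\Gamma_\alpha(\theta+2\pi\alpha)$ for all $\theta$.
   Context: A real number $\alpha$ is of bounded type if it is irrational and the partial quotients of its continued fraction expansion are bounded. Put $\lambda=e^{2\pi i\alpha}$. Let $m(x)=\sum_{k\ge1}m_kx^k$ (so $m(0)=0$) be the unique formal power series solution of $$m(\lambda x)-2m(x)+m(x/\lambda)=-x\,e^{m(x)}.$$ When $\alpha$ is of bounded type, the coefficients $m_k$ are positive, the radius of convergence $r_\alpha$ of $m$ is positive and finite, and the series converges uniformly on the closed disk $|x|\le r_\alpha$; thus $m$ is continuous on $|x|\le r_\alpha$ and holomorphic in $|x|<r_\alpha$. Set $Z(x)=x\,e^{m(x)}$ (so $Z(0)=0$, $Z'(0)=1$), and for $|x|\le r_\alpha$ define $$\Gamma(x)=(Z(x),\,m(\lambda x)-m(x))\in\mathbb{C}^2,\qquad \Gamma_\alpha(\theta)=\Gamma(r_\alpha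 e^{i\theta}),\quad \theta\in\mathbb{R}/2\pi\mathbb{Z}.$$ The underlying dynamical system is the map $(Z,W)\mapsto(ZWe^{-Z},\,We^{-Z})$, whose Siegel disk centered at $(0,\lambda)$ is parametrized by $x\mapsto (Z(x),W(x))$ with $W(\lambda x)=Z(\lambda x)/Z(x)=\lambda e^{m(\lambda x)-m(x)}$, the dynamics acting as $x\mapsto\lambda x$. In the coordinates $(Z,u)$ used by $\Gamma$, where $u=m(\lambda x)-m(x)$, the dynamics is $$T(Z,u)=(\lambda Ze^{u},\;u-\lambda Ze^{u}).$$ *)

(* Defs.v *)
(* Stdlib reals with Coquelicot. *)
From Stdlib Require Import Reals ZArith Lra Lia ClassicalEpsilon.
From Coquelicot Require Import Coquelicot.

Open Scope R_scope.

(** * Numbers of bounded type *)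

Definition irrational (alpha : R) : Prop :=
  forall p q : Z, q <> 0%Z -> alpha <> IZR p / IZR q.

(* [complete_quotient alpha n] is the [alpha_n] of
   [alpha = [a_0; a_1, ..., a_(n-1), alpha_n]].  For irrational [alpha] the
   expansion is infinite and the inversion is never applied to 0. *)
Fixpoint complete_quotient (alpha : R) (n : nat) : R :=
  match n with
  | O => alpha
  | S n' => / (complete_quotient alpha n' - IZR (Zfloor (complete_quotient alpha n')))
  end.

Definition partial_quotient (alpha : R) (n : nat) : Z :=
  Zfloor (complete_quotient alpha n).

Definition bounded_type (alpha : R) : Prop :=
  irrational alpha /\
  exists B : Z, forall n : nat, (Z.abs (partial_quotient alpha n) <= B)%Z.

Definition Cexp (z : C) : C :=
  (exp (Re z) * cos (Im z), exp (Re z) * sin (Im z)).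

Definition lambda (alpha : R) : C := Cexp (Ci * RtoC (2 * PI * alpha)).

(** * Formal power series, as coefficient sequences *)

Definition fps := nat -> C.

Definition fps_mul (a b : fps) : fps :=
  fun k => sum_n (fun i => a i * b (k - i)%nat)%C k.

Fixpoint fps_pow (a : fps) (n : nat) : fps :=
  match n with
  | O => fun k => match k with O => RtoC 1 | S _ => RtoC 0 end
  | S n' => fps_mul a (fps_pow a n')
  end.

(* The exponential [sum_n a^n / n!] of a series with zero constant term: then
   [a^n] is divisible by [x^n], so only [n <= k] contributes to degree [k]. *)
Definition fps_exp (a : fps) : fps :=
  fun k => sum_n (fun n => fps_pow a n k / RtoC (INR (fact n)))%C k.

Definition fps_mulX (a : fps) : fps :=
  fun k => match k with O => RtoC 0 | S k' => a k' end.

(* The series [a(c x)]. *)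
Definition fps_dilate (c : C) (a : fps) : fps := fun k => (c ^ k * a k)%C.

(* [m(lambda x) - 2 m(x) + m(x / lambda) = - x e^(m(x))] and [m(0) = 0]. *)
Definition formal_solution (alpha : R) (m : fps) : Prop :=
  m O = RtoC 0 /\
  forall k : nat,
    (fps_dilate (lambda alpha) m k - 2 * m k
       + fps_dilate (/ lambda alpha) m k)%C
    = (- fps_mulX (fps_exp m) k)%C.

(* For irrational [alpha] this is the unique formal solution: see
   [m_coef_solution] and [m_coef_unique] at the end of this file. *)
Definition m_coef (alpha : R) : fps :=
  epsilon (inhabits (fun _ => RtoC 0)) (formal_solution alpha).

(** * The boundary curve *)

(* The radius of convergence is positive and finite when [alpha] is of bounded
   type; [real] would send an infinite radius to 0. *)
Definition radius (alpha : R) : R :=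
  real (CV_radius (fun k => Cmod (m_coef alpha k))).

(* The sum of the power series at [x], wherever it converges. *)
Definition m_fun (alpha : R) (x : C) : C :=
  @iota C_CompleteNormedModule (@is_pseries C_AbsRing C_NormedModule (m_coef alpha) x).

Definition Z_fun (alpha : R) (x : C) : C := (x * Cexp (m_fun alpha x))%C.

Definition C2 : NormedModule R_AbsRing :=
  prod_NormedModule R_AbsRing C_R_NormedModule C_R_NormedModule.

Definition Gamma_disk (alpha : R) (x : C) : C2 :=
  (Z_fun alpha x, (m_fun alpha (lambda alpha * x) - m_fun alpha x)%C).

(* Maps on R/2piZ are represented by their 2pi-periodic lifts to R. *)
Definition Gamma (alpha : R) (theta : R) : C2 :=
  Gamma_disk alpha (RtoC (radius alpha) * Cexp (Ci * RtoC theta))%C.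

Definition dynamics (alpha : R) (p : C2) : C2 :=
  let Z := fst p in
  let u := snd p in
  ((lambda alpha * Z * Cexp u)%C, (u - lambda alpha * Z * Cexp u)%C).

(** * Maps defined on the circle R/2piZ *)

Definition same_angle (s t : R) : Prop := exists k : Z, s = t + 2 * PI * IZR k.

Definition circle_map (f : R -> C2) : Prop :=
  forall s t : R, same_angle s t -> f s = f t.

Definition circle_injective (f : R -> C2) : Prop :=
  forall s t : R, f s = f t -> same_angle s t.

Definition class_C1 (f : R -> C2) : Prop :=
  exists f' : R -> C2,
    (forall t : R, is_derive f t (f' t)) /\
    (forall t : R, continuous f' t).

Definition immersion (f : R -> C2) : Prop :=
  class_C1 f /\ forall (t : R) (l : C2), is_derive f t l -> l <> zero.

Definition embedding (f : R -> C2) : Prop :=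
  circle_map f /\ immersion f /\ circle_injective f.

Definition image (f : R -> C2) (U : R -> Prop) (p : C2) : Prop :=
  exists t : R, U t /\ f t = p.

Definition curve (f : R -> C2) : C2 -> Prop := image f (fun _ => True).

(* Open sets of R/2piZ (quotient topology), given by their preimages in R. *)
Definition circle_open (U : R -> Prop) : Prop :=
  open U /\ forall s t : R, same_angle s t -> U s -> U t.

(* [f] induces a continuous bijection of the circle onto [curve f] that is
   open for the subspace topology of [curve f]. *)
Definition homeomorphism_onto_image (f : R -> C2) : Prop :=
  circle_map f /\
  circle_injective f /\
  (forall V : C2 -> Prop, open V -> circle_open (fun t => V (f t))) /\
  (forall U : R -> Prop, circle_open U ->
     exists V : C2 -> Prop, open V /\
       forall p : C2, image f U p <-> curve f p /\ V p).

(* [F] maps [curve f] into itself, acting there as the rotation by [omega]. *)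
Definition conjugates_rotation (f : R -> C2) (omega : R) (F : C2 -> C2) : Prop :=
  homeomorphism_onto_image f /\ forall t : R, F (f t) = f (t + omega).

(** * Existence and uniqueness of the formal solution *)

Lemma sum_n_C_ext (a b : nat -> C) (n : nat) :
  (forall i, (i <= n)%nat -> a i = b i) -> sum_n a n = sum_n b n.
Proof. intros H. apply sum_n_ext_loc. exact H. Qed.

Lemma fps_pow_ext (a b : fps) (k : nat) :
  (forall j, (j <= k)%nat -> a j = b j) ->
  forall n j, (j <= k)%nat -> fps_pow a n j = fps_pow b n j.
Proof.
intros H n; induction n as [|n IH]; intros j Hj; simpl; auto.
unfold fps_mul. apply sum_n_C_ext. intros i Hi.
rewrite H, IH by lia. reflexivity.
Qed.

Lemma fps_mulX_exp_ext (a b : fps) (k : nat) :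
  (forall j, (j < k)%nat -> a j = b j) ->
  fps_mulX (fps_exp a) k = fps_mulX (fps_exp b) k.
Proof.
destruct k as [|k]; intros H; simpl; auto.
unfold fps_exp. apply sum_n_C_ext. intros n Hn.
rewrite (fps_pow_ext a b k); auto. intros j Hj; apply H; lia.
Qed.

Lemma Cexp_add (z w : C) : Cexp (z + w)%C = (Cexp z * Cexp w)%C.
Proof.
destruct z as [a b], w as [c d]. unfold Cexp, Cmult, Cplus, Re, Im; simpl.
rewrite exp_plus, cos_plus, sin_plus. f_equal; ring.
Qed.

Lemma Cexp_opp_l (z : C) : (Cexp (- z) * Cexp z)%C = RtoC 1.
Proof.
rewrite <- Cexp_add. replace (- z + z)%C with (RtoC 0) by ring.
unfold Cexp, RtoC; simpl. rewrite exp_0, cos_0, sin_0. f_equal; ring.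
Qed.

Lemma Cexp_neq_0 (z : C) : Cexp z <> RtoC 0.
Proof.
intros H. assert (E := Cexp_opp_l z). rewrite H, Cmult_0_r in E.
apply RtoC_inj in E. lra.
Qed.

Lemma lambda_pow (alpha : R) (k : nat) :
  (lambda alpha ^ k)%C = Cexp (Ci * RtoC (2 * PI * alpha * INR k)).
Proof.
unfold lambda. induction k as [|k IH].
- simpl. unfold Cexp, RtoC; simpl.
  rewrite ?Rmult_0_r, ?Rmult_0_l, ?Rminus_0_r, ?Rplus_0_r.
  rewrite exp_0, cos_0, sin_0. f_equal; ring.
- rewrite Cpow_S, IH, <- Cexp_add. f_equal.
  rewrite S_INR, !RtoC_mult, RtoC_plus. ring.
Qed.

Lemma lambda_pow_neq_1 (alpha : R) (k : nat) :
  irrational alpha -> (k <> 0)%nat -> (lambda alpha ^ k)%C <> RtoC 1.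
Proof.
intros Ha Hk H. rewrite lambda_pow in H.
apply (f_equal fst) in H. unfold Cexp, RtoC in H; simpl in H.
replace (0 * (2 * PI * alpha * INR k) - 1 * 0) with 0 in H by ring.
replace (0 * 0 + 1 * (2 * PI * alpha * INR k))
  with (2 * (PI * alpha * INR k)) in H by ring.
rewrite exp_0, cos_2a_sin in H.
assert (Hs : sin (PI * alpha * INR k) = 0) by nra.
apply sin_eq_0_0 in Hs. destruct Hs as [p Hp].
apply (Ha p (Z.of_nat k)); [lia|].
assert (HP := PI_RGT_0).
assert (INR k <> 0) by (apply not_0_INR; exact Hk).
rewrite <- INR_IZR_INZ.
apply Rmult_eq_reg_r with (INR k * PI); [|nra].
field_simplify; [|auto]. lra.
Qed.

Definition small_divisor (alpha : R) (k : nat) : C :=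
  (lambda alpha ^ k - 2 + (/ lambda alpha) ^ k)%C.

Lemma small_divisor_neq_0 (alpha : R) (k : nat) :
  irrational alpha -> (k <> 0)%nat -> small_divisor alpha k <> RtoC 0.
Proof.
intros Ha Hk H. unfold small_divisor in H.
assert (Hl : lambda alpha <> RtoC 0) by apply Cexp_neq_0.
rewrite (Cpow_inv _ _ Hl) in H.
assert (Hp := Cpow_nz _ k Hl). assert (Hn := lambda_pow_neq_1 _ _ Ha Hk).
set (w := (lambda alpha ^ k)%C) in *.
assert (E : ((w - 1) * (w - 1))%C = RtoC 0).
{ transitivity ((w - 2 + / w) * w)%C.
  - field. exact Hp.
  - rewrite H. ring. }
apply (Cmult_neq_0 (w - 1) (w - 1)); [| |exact E];
  intros F; apply Hn; replace w with ((w - 1) + 1)%C by ring; rewrite F; ring.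
Qed.

Definition solution_step (alpha : R) (m : fps) : fps :=
  fun k => match k with
           | O => RtoC 0
           | S _ => (- fps_mulX (fps_exp m) k / small_divisor alpha k)%C
           end.

Lemma solution_step_ext (alpha : R) (a b : fps) (k : nat) :
  (forall j, (j < k)%nat -> a j = b j) ->
  solution_step alpha a k = solution_step alpha b k.
Proof.
intros H. destruct k as [|k]; [reflexivity|].
unfold solution_step. now rewrite (fps_mulX_exp_ext a b).
Qed.

Lemma formal_solution_step (alpha : R) (m : fps) :
  irrational alpha ->
  (formal_solution alpha m <-> forall k, m k = solution_step alpha m k).
Proof.
intros Ha. unfold formal_solution, fps_dilate. split.
- intros [H0 H] [|k]; [exact H0|].
  assert (Hd := small_divisor_neq_0 _ (S k) Ha ltac:(lia)).
  unfold solution_step. rewrite <- (H (S k)).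
  unfold small_divisor in *. field. exact Hd.
- intros H. split; [exact (H O)|]. intros [|k].
  + rewrite (H O). simpl. ring.
  + assert (Hd := small_divisor_neq_0 _ (S k) Ha ltac:(lia)).
    transitivity (small_divisor alpha (S k) * m (S k))%C.
    * unfold small_divisor. ring.
    * rewrite (H (S k)). unfold solution_step. field. exact Hd.
Qed.

Lemma formal_solution_exists (alpha : R) :
  irrational alpha -> exists m : fps, formal_solution alpha m.
Proof.
intros Ha.
pose (M := fix M (n : nat) : fps :=
  match n with
  | O => fun _ => RtoC 0
  | S n' => solution_step alpha (M n')
  end).
assert (HM : forall k n p, (k < n)%nat -> (k < p)%nat -> M n k = M p k).
{ intros k; induction k as [k IH] using (well_founded_induction lt_wf).
  intros [|n] [|p] Hn Hp; try lia. cbn [M].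
  apply solution_step_ext. intros j Hj. apply IH; lia. }
exists (fun k => M (S k) k). apply formal_solution_step; [exact Ha|].
intros k. cbn [M]. apply solution_step_ext. intros j Hj. apply (HM j k (S j)); lia.
Qed.

Lemma formal_solution_unique (alpha : R) (m m' : fps) :
  irrational alpha -> formal_solution alpha m -> formal_solution alpha m' ->
  forall k, m k = m' k.
Proof.
intros Ha H H'. rewrite formal_solution_step in H, H' by exact Ha.
intros k; induction k as [k IH] using (well_founded_induction lt_wf).
rewrite H, H'. now apply solution_step_ext.
Qed.

Lemma m_coef_solution (alpha : R) :
  irrational alpha -> formal_solution alpha (m_coef alpha).
Proof. intros Ha. unfold m_coef. apply epsilon_spec. now apply formal_solution_exists. Qed.

Lemma m_coef_unique (alpha : R) (m : fps) :
  irrational alpha -> formal_solution alpha m -> forall k, m k = m_coef alpha k.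
Proof.
intros Ha H. apply (formal_solution_unique alpha); auto.
now apply m_coef_solution.
Qed.

(* Main.v *)
Require Import Defs.
From Stdlib Require Import Reals ZArith Lra Lia ClassicalEpsilon.
From Coquelicot Require Import Coquelicot.
Open Scope R_scope.

(** Comparing coefficients, [4 sin^2(pi k alpha) m_k] is the coefficient of
    [x^(k-1)] in [e^m], so the [m_k] are nonnegative reals.  Two bounds on
    the divisors control the radius of convergence [r].

    From above, [4 sin^2 <= 4] gives [x e^(m(x)) <= 4 m(x)] for [0 <= x < r].
    Hence [x <= 4], so [r] is finite, and [x m(x) <= 16], so [m] stays bounded
    up to [r] and the series converges absolutely at [r]
    ([m_real_sum_inequality], [radius_spec]).

    From below, bounded type gives [|sin(pi k alpha)| >= c / k]
    ([divisor_lower_bound]), and two indices with small divisors are far apart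
    because their difference has a small divisor as well.  This yields
    supermultiplicative weights [W] of geometric growth that absorb one divisor
    at each step ([divisor_weights]); then [m_k / W_k] satisfies a recursion
    without small divisors, and [m_k] grows at most geometrically
    ([m_real_geometric_bound]), so [r > 0].

    On the closed disk the formal exponential of [m] sums to [e^(m(x))]
    ([Cseries_fps_exp]), so the functional equation holds up to the boundary;
    it is the conjugacy [T (Gamma t) = Gamma (t + 2 pi alpha)]
    ([Gamma_conjugacy]).

    If [Gamma] takes the same value at two boundary points [x] and [y], it does
    so along their orbits.  The component [u = sum (lambda^k - 1) m_k x^k] is
    then equal at [lambda^j x] and [lambda^j y] for all [j], and averaging with
    the factors [lambda^(-j)] isolates the linear term: [x = y]
    ([orbit_determines_linear_coefficient], [Gamma_injective]).

    If [Gamma'] vanished at one parameter, it would vanish along its orbit under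
    the rotation, by the conjugacy, hence everywhere, by density and continuity;
    [Gamma] would be constant, against injectivity ([Gamma_immersion]).  Finally
    a continuous injection of a compact space is a homeomorphism onto its image
    ([continuous_injective_homeomorphism]). *)

(** * Continued fractions *)

Definition frac_quotient (alpha : R) (n : nat) : R :=
  complete_quotient alpha n - IZR (partial_quotient alpha n).

(** Convergents with indices shifted by one, so that the recursion starts from
    the formal convergent [1/0]. *)
Fixpoint conv_den (alpha : R) (n : nat) : Z :=
  match n with
  | O => 0
  | S n' => match n' with
            | O => 1
            | S n'' => partial_quotient alpha n' * conv_den alpha n' + conv_den alpha n''
            end
  end%Z.

Fixpoint conv_num (alpha : R) (n : nat) : Z :=
  match n with
  | O => 1
  | S n' => match n' with
            | O => partial_quotient alpha 0
            | S n'' => partial_quotient alpha n' * conv_num alpha n' + conv_num alpha n''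
            end
  end%Z.

(** This is [|q alpha - p|] for the convergent [p / q] of the same index. *)
Fixpoint conv_err (alpha : R) (n : nat) : R :=
  match n with
  | O => 1
  | S n' => conv_err alpha n' * frac_quotient alpha n'
  end.

Lemma complete_quotient_S alpha n :
  complete_quotient alpha (S n) = / frac_quotient alpha n.
Proof. reflexivity. Qed.

Lemma irrational_not_integer alpha (p : Z) : irrational alpha -> alpha <> IZR p.
Proof. intros H E. apply (H p 1%Z); [lia|]. rewrite E. field. Qed.

Lemma irrational_frac_inv alpha (a : Z) :
  irrational alpha -> irrational (/ (alpha - IZR a)).
Proof.
intros H p q Hq E.
assert (Ha : alpha - IZR a <> 0).
{ intros F. apply (irrational_not_integer alpha a H). lra. }
assert (Hq' : IZR q <> 0) by now apply not_0_IZR.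
assert (Hp : IZR p <> 0).
{ intros F. rewrite F in E. unfold Rdiv in E. rewrite Rmult_0_l in E.
  now apply Rinv_neq_0_compat in Ha. }
apply (H (a * p + q)%Z p); [intros ->; now apply Hp|].
rewrite plus_IZR, mult_IZR.
assert (E2 : alpha - IZR a = IZR q / IZR p).
{ rewrite <- (Rinv_inv (alpha - IZR a)), E. field. now split. }
replace alpha with (IZR a + IZR q / IZR p) by lra. field. assumption.
Qed.

Lemma irrational_complete_quotient alpha n :
  irrational alpha -> irrational (complete_quotient alpha n).
Proof.
intros H. induction n as [|n IH]; [exact H|]. simpl. now apply irrational_frac_inv.
Qed.

Lemma frac_quotient_bound alpha n :
  irrational alpha -> 0 < frac_quotient alpha n < 1.
Proof.
intros H. unfold frac_quotient, partial_quotient.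
assert (B := Zfloor_bound (complete_quotient alpha n)).
assert (N := irrational_not_integer _ (Zfloor (complete_quotient alpha n))
  (irrational_complete_quotient alpha n H)).
lra.
Qed.

Lemma partial_quotient_pos alpha n :
  irrational alpha -> (1 <= partial_quotient alpha (S n))%Z.
Proof.
intros H. unfold partial_quotient. apply Zfloor_lub.
rewrite complete_quotient_S. assert (B := frac_quotient_bound alpha n H).
rewrite <- Rinv_1. apply Rinv_le_contravar; lra.
Qed.

Lemma conv_err_pos alpha n : irrational alpha -> 0 < conv_err alpha n.
Proof.
intros H. induction n as [|n IH]; simpl; [lra|].
assert (B := frac_quotient_bound alpha n H). now apply Rmult_lt_0_compat.
Qed.

Lemma conv_err_rec alpha n : irrational alpha ->
  conv_err alpha (S (S n)) =
  conv_err alpha n - IZR (partial_quotient alpha (S n)) * conv_err alpha (S n).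
Proof.
intros H. cbn [conv_err]. assert (B := frac_quotient_bound alpha n H).
replace (frac_quotient alpha (S n))
  with (/ frac_quotient alpha n - IZR (partial_quotient alpha (S n)))
  by (rewrite <- complete_quotient_S; reflexivity).
field. lra.
Qed.

Lemma conv_err_spec alpha n : irrational alpha ->
  IZR (conv_den alpha n) * alpha - IZR (conv_num alpha n) = - (- 1) ^ n * conv_err alpha n.
Proof.
intros H.
enough (IZR (conv_den alpha n) * alpha - IZR (conv_num alpha n) = - (- 1) ^ n * conv_err alpha n
  /\ IZR (conv_den alpha (S n)) * alpha - IZR (conv_num alpha (S n))
     = - (- 1) ^ (S n) * conv_err alpha (S n)) by tauto.
induction n as [|n [IH1 IH2]].
- simpl. unfold frac_quotient. simpl. lra.
- split; [exact IH2|]. rewrite conv_err_rec by exact H.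
  change (conv_den alpha (S (S n))) with
    (partial_quotient alpha (S n) * conv_den alpha (S n) + conv_den alpha n)%Z.
  change (conv_num alpha (S (S n))) with
    (partial_quotient alpha (S n) * conv_num alpha (S n) + conv_num alpha n)%Z.
  rewrite !plus_IZR, !mult_IZR.
  set (a := IZR (partial_quotient alpha (S n))) in *.
  transitivity (a * (IZR (conv_den alpha (S n)) * alpha - IZR (conv_num alpha (S n)))
    + (IZR (conv_den alpha n) * alpha - IZR (conv_num alpha n))); [ring|].
  rewrite IH1, IH2. cbn [pow]. ring.
Qed.

Lemma conv_den_nonneg alpha n : irrational alpha ->
  (0 <= conv_den alpha n /\ 1 <= conv_den alpha (S n))%Z.
Proof.
intros H. induction n as [|n [IH1 IH2]]; [simpl; lia|]. split; [lia|].
change (conv_den alpha (S (S n))) with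
    (partial_quotient alpha (S n) * conv_den alpha (S n) + conv_den alpha n)%Z.
assert (P := partial_quotient_pos alpha n H). nia.
Qed.

Lemma conv_den_err alpha n : irrational alpha ->
  IZR (conv_den alpha (S n)) * conv_err alpha n
  + IZR (conv_den alpha n) * conv_err alpha (S n) = 1.
Proof.
intros H. induction n as [|n IH]; [simpl; lra|].
rewrite conv_err_rec by exact H.
change (conv_den alpha (S (S n))) with
    (partial_quotient alpha (S n) * conv_den alpha (S n) + conv_den alpha n)%Z.
rewrite plus_IZR, mult_IZR. rewrite <- IH. ring.
Qed.

Lemma conv_err_half alpha n : irrational alpha ->
  conv_err alpha (S (S n)) <= conv_err alpha n / 2.
Proof.
intros H. rewrite conv_err_rec by exact H.
assert (P := IZR_le _ _ (partial_quotient_pos alpha n H)).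
assert (P1 := conv_err_pos alpha (S n) H).
assert (P2 := conv_err_pos alpha (S (S n)) H). rewrite conv_err_rec in P2 by exact H.
assert (B := frac_quotient_bound alpha (S n) H).
assert (E := conv_err_rec alpha n H).
change (conv_err alpha (S (S n))) with (conv_err alpha (S n) * frac_quotient alpha (S n)) in E.
nra.
Qed.

Lemma conv_err_small alpha eps : irrational alpha -> 0 < eps ->
  exists n, conv_err alpha n < eps.
Proof.
intros H He.
assert (G : forall n, conv_err alpha (2 * n) <= (1/2) ^ n).
{ induction n as [|n IH]; [simpl; lra|].
  replace (2 * S n)%nat with (S (S (2 * n))) by lia.
  assert (Q := conv_err_half alpha (2 * n) H). cbn [pow]. lra. }
destruct (pow_lt_1_zero (1/2) ltac:(rewrite Rabs_pos_eq; lra) eps He) as [N HN].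
exists (2 * N)%nat. specialize (HN N (le_n _)). specialize (G N).
assert (0 <= (1/2)^N) by (apply pow_le; lra).
rewrite Rabs_pos_eq in HN by assumption. lra.
Qed.

(** Let [n] be the first index with [conv_err n <= 1 / (2 k)].  If the
    determinant [k p_n - p q_n] is nonzero it is at least 1 in absolute value,
    and it equals [q_n (k alpha - p) - k (q_n alpha - p_n)], whose second term
    is at most 1/2; if it vanishes, [k alpha - p] is [k / q_n] times the error
    of the convergent.  In both cases [q_n < 2 k]; the bound on the partial
    quotients is what keeps [conv_err n] from being much smaller than
    [conv_err (n - 1)]. *)
Lemma bounded_type_diophantine alpha : bounded_type alpha ->
  exists c, 0 < c /\ forall (k : nat) (p : Z), (1 <= k)%nat ->
    c / INR k <= Rabs (INR k * alpha - IZR p).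
Proof.
intros [Hi [B HB]].
assert (HB1 : 1 <= IZR B).
{ apply IZR_le. specialize (HB 1%nat).
  assert (P := partial_quotient_pos alpha 0 Hi). lia. }
exists (/ (4 * (IZR B + 1))). split; [apply Rinv_0_lt_compat; lra|].
intros k p Hk.
assert (Hk1 : 1 <= INR k) by (apply (le_INR 1); exact Hk).
assert (Hmin : exists n, / (2 * INR k) < conv_err alpha n /\
  conv_err alpha (S n) <= / (2 * INR k)).
{ destruct (conv_err_small alpha (/ (2 * INR k)) Hi) as [N HN].
  { apply Rinv_0_lt_compat; lra. }
  induction N as [|N IH].
  - exfalso. simpl in HN. assert (/ (2 * INR k) <= / 2).
    { apply Rinv_le_contravar; lra. } lra.
  - destruct (Rle_lt_dec (conv_err alpha N) (/ (2 * INR k))) as [L|L].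
    + destruct L as [L|L]; [now apply IH|].
      destruct N as [|N]; [|].
      * exfalso. simpl in L. assert (/ (2 * INR k) <= / 2).
        { apply Rinv_le_contravar; lra. } lra.
      * exists N. split; [|lra].
        assert (Q := frac_quotient_bound alpha N Hi).
        assert (Q2 := conv_err_pos alpha N Hi). cbn [conv_err] in L. nra.
    + exists N. split; lra. }
destruct Hmin as [n [Hn1 Hn2]].
assert (Hq := conv_den_nonneg alpha n Hi). destruct Hq as [Hq0 Hq1].
assert (Hs := conv_err_spec alpha (S n) Hi).
assert (Hd := conv_den_err alpha n Hi).
assert (Hp0 := conv_err_pos alpha n Hi). assert (Hp1 := conv_err_pos alpha (S n) Hi).
apply IZR_le in Hq0. assert (Hq1' := IZR_le _ _ Hq1).
set (q := IZR (conv_den alpha (S n))) in *. set (q0 := IZR (conv_den alpha n)) in *.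
set (D := conv_err alpha n) in *.
assert (HD : D / (IZR B + 1) <= conv_err alpha (S n)).
{ change (conv_err alpha (S n)) with (D * frac_quotient alpha n).
  apply Rmult_le_compat_l; [lra|].
  rewrite <- (Rinv_inv (frac_quotient alpha n)), <- complete_quotient_S.
  assert (F := Zfloor_bound (complete_quotient alpha (S n))).
  assert (F2 := HB (S n)). assert (F3 := partial_quotient_pos alpha n Hi).
  unfold partial_quotient in F2, F3.
  assert (F4 : IZR (Zfloor (complete_quotient alpha (S n))) <= IZR B) by (apply IZR_le; lia).
  apply IZR_le in F3.
  apply Rinv_le_contravar; lra. }
set (D1 := conv_err alpha (S n)) in *.
assert (HqD : q < 2 * INR k).
{ apply Rmult_lt_reg_r with D; [lra|].
  assert (2 * INR k * / (2 * INR k) = 1) by (field; lra). nra. }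
assert (Habs : Rabs (q * alpha - IZR (conv_num alpha (S n))) = D1).
{ rewrite Hs, Rabs_mult, Rabs_Ropp, pow_1_abs. rewrite Rabs_pos_eq; lra. }
set (X := Rabs (INR k * alpha - IZR p)).
assert (HX : 0 <= X) by apply Rabs_pos.
assert (HkD : / (2 * INR k) * INR k = / 2) by (field; lra).
assert (Hgoal : forall y, y = / (4 * (IZR B + 1)) / INR k -> y * (4 * INR k * (IZR B + 1)) = 1).
{ intros y ->. field. lra. }
set (y := / (4 * (IZR B + 1)) / INR k) in *. specialize (Hgoal y eq_refl).
destruct (Z.eq_dec (Z.of_nat k * conv_num alpha (S n) - p * conv_den alpha (S n)) 0) as [Z0|Z0].
- assert (E : q * X = INR k * D1).
  { unfold X. rewrite <- Habs. rewrite <- (Rabs_pos_eq q) at 1 by lra.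
    rewrite <- (Rabs_pos_eq (INR k)) at 2 by lra. rewrite <- !Rabs_mult. f_equal.
    apply (f_equal IZR) in Z0. rewrite minus_IZR, !mult_IZR, <- INR_IZR_INZ in Z0.
    fold q in Z0. lra. }
  assert (E1 : INR k * D1 <= 2 * INR k * X) by nra.
  assert (E2 : D1 <= 2 * X) by nra.
  assert (E3 : D / (IZR B + 1) * (IZR B + 1) = D) by (field; lra).
  assert (E4 : D <= 2 * X * (IZR B + 1)) by nra.
  assert (E5 : / 2 < D * INR k) by nra.
  apply Rmult_le_reg_r with (4 * INR k * (IZR B + 1)); nra.
- assert (E : 1 <= q * X + INR k * D1).
  { unfold X. rewrite <- Habs. rewrite <- (Rabs_pos_eq q) at 1 by lra.
    rewrite <- (Rabs_pos_eq (INR k)) at 2 by lra. rewrite <- !Rabs_mult.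
    rewrite <- (Rabs_Ropp (INR k * (q * _ - _))).
    eapply Rle_trans; [|apply Rabs_triang].
    replace (q * (INR k * alpha - IZR p) + - (INR k * (q * alpha - IZR (conv_num alpha (S n)))))
      with (IZR (Z.of_nat k * conv_num alpha (S n) - p * conv_den alpha (S n))).
    - rewrite <- abs_IZR. apply IZR_le. lia.
    - rewrite minus_IZR, !mult_IZR, <- INR_IZR_INZ. fold q. ring. }
  assert (E1 : 1 <= 4 * INR k * X) by nra.
  apply Rmult_le_reg_r with (4 * INR k * (IZR B + 1)); nra.
Qed.

(** * Small divisors *)

(** Taylor's bound [x - x^3 / 6 <= sin x]. *)
Lemma sin_ge_third x : 0 <= x <= 2 -> x / 3 <= sin x.
Proof.
intros Hx. destruct (pre_sin_bound x 0) as [L _]; try lra.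
apply Rle_trans with (2 := L). unfold sin_approx, sin_term. simpl.
assert (0 <= x * (4 - x * x)) by (apply Rmult_le_pos; nra). nra.
Qed.

(** Half of [|lambda^k - 1|]. *)
Definition divisor (alpha : R) (k : nat) : R := Rabs (sin (PI * (INR k * alpha))).

Lemma Rabs_sin_shift x (p : Z) : Rabs (sin (x - PI * IZR p)) = Rabs (sin x).
Proof.
rewrite sin_minus.
assert (H : sin (PI * IZR p) = 0) by (apply sin_eq_0_1; exists p; ring).
assert (H2 := sin2_cos2 (PI * IZR p)). rewrite H in *. unfold Rsqr in H2.
rewrite Rmult_0_r, Rminus_0_r, Rabs_mult.
assert (Rabs (cos (PI * IZR p)) = 1); [|nra].
assert (E : (cos (PI * IZR p) - 1) * (cos (PI * IZR p) + 1) = 0) by nra.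
apply Rmult_integral in E.
destruct E as [E|E].
- replace (cos (PI * IZR p)) with 1 by lra. apply Rabs_R1.
- replace (cos (PI * IZR p)) with (-1) by lra. rewrite Rabs_left; lra.
Qed.

(** [|sin (pi y)| >= |y|] for [|y| <= 1/2], applied to the distance from
    [k alpha] to the nearest integer. *)
Lemma divisor_lower_bound alpha : bounded_type alpha ->
  exists c, 0 < c /\ forall k, (1 <= k)%nat -> c / INR k <= divisor alpha k.
Proof.
intros H. destruct (bounded_type_diophantine alpha H) as [c [Hc Hd]].
exists c. split; [exact Hc|]. intros k Hk.
set (p := Zfloor (INR k * alpha + / 2)).
assert (Hp := Zfloor_bound (INR k * alpha + / 2)). fold p in Hp.
specialize (Hd k p Hk). apply Rle_trans with (1 := Hd). unfold divisor.
rewrite <- (Rabs_sin_shift _ p).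
replace (PI * (INR k * alpha) - PI * IZR p) with (PI * (INR k * alpha - IZR p)) by ring.
set (y := INR k * alpha - IZR p) in *.
assert (Hy : - / 2 <= y <= / 2) by (unfold y; lra).
assert (P4 := PI_4). assert (P0 := PI2_3_2). unfold Rdiv in P0.
assert (G : forall z, 0 <= z <= / 2 -> z <= sin (PI * z)).
{ intros z Hz. apply Rle_trans with (PI * z / 3).
  - assert (3 * z <= PI * z) by (apply Rmult_le_compat_r; lra). lra.
  - apply sin_ge_third. split; [apply Rmult_le_pos; lra|].
    apply Rle_trans with (4 * / 2); [apply Rmult_le_compat|]; lra. }
destruct (Rle_lt_dec 0 y) as [L|L].
- rewrite Rabs_pos_eq by exact L. apply Rle_trans with (2 := Rle_abs _). apply G. lra.
- rewrite Rabs_left by exact L. rewrite <- Rabs_Ropp, <- sin_neg.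
  replace (- (PI * y)) with (PI * (- y)) by ring.
  apply Rle_trans with (2 := Rle_abs _). apply G. lra.
Qed.

Lemma divisor_sub alpha m n : (m <= n)%nat ->
  divisor alpha (n - m) <= divisor alpha n + divisor alpha m.
Proof.
intros H. unfold divisor. rewrite minus_INR by exact H.
replace (PI * ((INR n - INR m) * alpha))
  with (PI * (INR n * alpha) - PI * (INR m * alpha)) by ring.
set (a := PI * (INR n * alpha)). set (b := PI * (INR m * alpha)).
rewrite sin_minus. unfold Rminus. eapply Rle_trans; [apply Rabs_triang|].
rewrite Rabs_Ropp, !Rabs_mult.
assert (Ca : Rabs (cos a) <= 1) by (apply Rabs_le, COS_bound).
assert (Cb : Rabs (cos b) <= 1) by (apply Rabs_le, COS_bound).
assert (Sa := Rabs_pos (sin a)). assert (Sb := Rabs_pos (sin b)). nra.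
Qed.

Lemma divisor_le_1 alpha k : divisor alpha k <= 1.
Proof. apply Rabs_le, SIN_bound. Qed.

(** * Density of the orbits of an irrational rotation *)

(** The error of a good convergent is a nonzero step of length less than [eps]
    that is reached by iterating the rotation forwards; walking with this step
    passes within [eps] of any point. *)
Lemma irrational_rotation_dense alpha (y eps : R) : irrational alpha -> 0 < eps ->
  exists (n : nat) (k : Z), Rabs (INR n * alpha + IZR k - y) < eps.
Proof.
intros Hi He.
destruct (conv_err_small alpha eps Hi He) as [n Hn].
assert (Hq : (0 <= conv_den alpha n)%Z) by apply (conv_den_nonneg alpha n Hi).
assert (Hspec := conv_err_spec alpha n Hi).
assert (Hpos := conv_err_pos alpha n Hi).
set (d := IZR (conv_den alpha n) * alpha - IZR (conv_num alpha n)) in *.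
assert (Hd : d <> 0 /\ Rabs d < eps).
{ assert (A : Rabs d = conv_err alpha n).
  { rewrite Hspec, Rabs_mult, Rabs_Ropp, pow_1_abs, Rabs_pos_eq; lra. }
  split; [|lra]. intros E. rewrite E, Rabs_R0 in A. lra. }
destruct Hd as [Hd0 Hd1].
(* an integer translate of [y] lying on the side to which the multiples of [d] move *)
assert (HK : exists K : Z, 0 <= (y + IZR K) / d).
{ destruct (Rlt_le_dec 0 d) as [L|L].
  - exists (Z.opp (Zfloor y)). rewrite opp_IZR. assert (F := Zfloor_bound y).
    apply Rdiv_le_0_compat; lra.
  - exists (Z.opp (Zfloor y + 1)). rewrite opp_IZR, plus_IZR. assert (F := Zfloor_bound y).
    replace ((y + - (IZR (Zfloor y) + 1)) / d) with ((IZR (Zfloor y) + 1 - y) / (- d)) by (field; auto).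
    apply Rdiv_le_0_compat; lra. }
destruct HK as [K HK].
set (j := Zfloor ((y + IZR K) / d)).
assert (Hj := Zfloor_bound ((y + IZR K) / d)). fold j in Hj.
assert (Hj0 : (0 <= j)%Z) by (apply Zfloor_lub; exact HK).
exists (Z.to_nat (j * conv_den alpha n)), (- j * conv_num alpha n - K)%Z.
rewrite INR_IZR_INZ, Z2Nat.id by (apply Z.mul_nonneg_nonneg; lia).
rewrite minus_IZR, !mult_IZR, opp_IZR.
replace (IZR j * IZR (conv_den alpha n) * alpha + (- IZR j * IZR (conv_num alpha n) - IZR K) - y)
  with ((IZR j - (y + IZR K) / d) * d) by (unfold d in *; field; exact Hd0).
rewrite Rabs_mult. apply Rle_lt_trans with (1 * Rabs d); [|lra].
apply Rmult_le_compat_r; [apply Rabs_pos|]. apply Rabs_le. lra.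
Qed.

(** * Superadditive weights dominating the small divisors *)

Section OneScale.

Variables (M : R) (S : nat -> Prop).
Hypothesis M_pos : 0 < M.
Hypothesis S_ge : forall s, S s -> M <= INR s.
Hypothesis S_gap : forall s s', S s -> S s' -> (s < s')%nat -> M <= INR s' - INR s.

Let base (n : nat) : R := Rmax 0 (2 * INR n / M - 2).

(** The level is raised one unit above [base] at each point of [S] and kept
    until [base] catches up, which happens before the next point of [S]. *)
Fixpoint last_jump (n : nat) : R :=
  match n with
  | O => 0
  | Datatypes.S n' => if excluded_middle_informative (S n) then base n + 1 else last_jump n'
  end.

Let g (n : nat) : R := Rmax (base n) (last_jump n).

Lemma base_mono a b : (a <= b)%nat -> base a <= base b.
Proof.
intros H. apply le_INR in H. apply Rle_max_compat_l.
assert (2 * INR a / M <= 2 * INR b / M); [|lra].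
apply Rmult_le_compat_r; [left; now apply Rinv_0_lt_compat|lra].
Qed.

Lemma base_large n : M <= INR n -> base n = 2 * INR n / M - 2.
Proof.
intros H. apply Rmax_right.
assert (1 <= INR n / M) by (apply Rle_div_r; lra). lra.
Qed.

Lemma last_jump_spec n :
  last_jump n = 0 \/ exists s, (s <= n)%nat /\ S s /\ last_jump n = base s + 1.
Proof.
induction n as [|n IH]; [now left|]. simpl.
destruct (excluded_middle_informative (S (Datatypes.S n))) as [L|L].
- right. exists (Datatypes.S n). auto.
- destruct IH as [IH|(s & H1 & H2 & H3)]; [now left|]. right. exists s. auto.
Qed.

Lemma g_mono_succ n : g n <= g (Datatypes.S n).
Proof.
unfold g. apply Rmax_lub.
- eapply Rle_trans; [apply (base_mono n (Datatypes.S n)); lia|apply Rmax_l].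
- simpl. destruct (excluded_middle_informative (S (Datatypes.S n))) as [L|L].
  + eapply Rle_trans; [|apply Rmax_r].
    destruct (last_jump_spec n) as [E|(s & H1 & H2 & E)]; rewrite E.
    * assert (0 <= base (Datatypes.S n)) by apply Rmax_l. lra.
    * assert (base s <= base (Datatypes.S n)) by (apply base_mono; lia). lra.
  + apply Rmax_r.
Qed.

Lemma g_mono a b : (a <= b)%nat -> g a <= g b.
Proof.
induction 1 as [|b H IH]; [lra|]. apply Rle_trans with (1 := IH), g_mono_succ.
Qed.

Lemma g_small n : INR n < M -> g n = 0.
Proof.
intros H. unfold g.
assert (B : base n = 0).
{ apply Rmax_left. assert (INR n / M < 1) by (apply Rlt_div_l; lra). lra. }
rewrite B. destruct (last_jump_spec n) as [E|(s & H1 & H2 & E)].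
- rewrite E. apply Rmax_left. lra.
- apply le_INR in H1. specialize (S_ge s H2). lra.
Qed.

Lemma g_large n : M <= INR n -> 2 * INR n / M - 2 <= g n <= 2 * INR n / M - 1.
Proof.
intros H. rewrite <- (base_large n H). unfold g. split; [apply Rmax_l|].
assert (E1 := base_large n H).
apply Rmax_lub; [lra|].
assert (1 <= INR n / M) by (apply Rle_div_r; lra).
destruct (last_jump_spec n) as [E|(s & H1 & H2 & E)]; rewrite E.
- lra.
- assert (base s <= base n) by now apply base_mono. lra.
Qed.

Lemma g_superadditive a b : g a + g b <= g (a + b)%nat.
Proof.
destruct (Rlt_le_dec (INR a) M) as [La|La].
{ rewrite (g_small a La), Rplus_0_l. apply g_mono. lia. }
destruct (Rlt_le_dec (INR b) M) as [Lb|Lb].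
{ rewrite (g_small b Lb), Rplus_0_r. apply g_mono. lia. }
assert (Hab : INR (a + b) = INR a + INR b) by apply plus_INR.
assert (Ga := g_large a La). assert (Gb := g_large b Lb).
assert (Gab := g_large (a + b) ltac:(rewrite Hab; lra)).
rewrite Hab in Gab.
replace (2 * (INR a + INR b) / M) with (2 * INR a / M + 2 * INR b / M) in Gab by (field; lra).
lra.
Qed.

Lemma g_jump n : S (Datatypes.S n) -> g n + 1 <= g (Datatypes.S n).
Proof.
intros H. apply Rle_trans with (base (Datatypes.S n) + 1).
- apply Rplus_le_compat_r. apply Rmax_lub; [apply base_mono; lia|].
  destruct (last_jump_spec n) as [E|(s & H1 & H2 & E)]; rewrite E; [apply Rmax_l|].
  assert (H3 := S_gap s (Datatypes.S n) H2 H ltac:(lia)).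
  assert (H4 := S_ge s H2).
  rewrite !base_large by lra.
  assert (1 <= (INR (Datatypes.S n) - INR s) / M) by (apply Rle_div_r; lra).
  replace (2 * INR (Datatypes.S n) / M)
    with (2 * INR s / M + 2 * ((INR (Datatypes.S n) - INR s) / M)) by (field; lra).
  lra.
- unfold g. eapply Rle_trans; [|apply Rmax_r]. simpl last_jump.
  destruct (excluded_middle_informative (S (Datatypes.S n))); [lra|contradiction].
Qed.

Lemma g_linear n : g n <= 2 / M * INR n.
Proof.
assert (0 < 2 / M) by (apply Rdiv_lt_0_compat; lra).
replace (2 / M * INR n) with (2 * INR n / M) by (field; lra).
destruct (Rlt_le_dec (INR n) M) as [L|L].
- rewrite (g_small n L). assert (0 <= INR n) by apply pos_INR.
  apply Rdiv_le_0_compat; lra.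
- assert (G := g_large n L). lra.
Qed.

(** The function is squeezed between [2 n / M - 2] and [2 n / M - 1] once
    [n >= M] and vanishes before: two large arguments lose a whole unit, which
    makes any monotone function in this strip superadditive.  The strip is wide
    enough for a unit jump at each point of a set with gaps [M]. *)
Lemma superadditive_with_jumps : exists g : nat -> R,
  g 0%nat = 0 /\
  (forall a b, g a + g b <= g (a + b)%nat) /\
  (forall n, g n <= g (Datatypes.S n)) /\
  (forall n, S (Datatypes.S n) -> g n + 1 <= g (Datatypes.S n)) /\
  (forall n, g n <= 2 / M * INR n).
Proof.
exists g. split; [apply g_small; simpl; lra|].
auto using g_superadditive, g_mono_succ, g_jump, g_linear.
Qed.

End OneScale.

(** Adding up one function per dyadic scale [d n < (1/2)^j]: consecutive
    elements of that set differ by at least [c 2^j / 2], because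
    [d (n' - n) < 2 (1/2)^j], so the linear growth rates form a geometric
    series. *)
Lemma superadditive_for_divisors (d : nat -> R) (c : R) :
  0 < c ->
  (forall k, (1 <= k)%nat -> c / INR k <= d k) ->
  (forall m n, (m <= n)%nat -> d (n - m)%nat <= d n + d m) ->
  forall J : nat, exists K : nat -> R,
    K 0%nat = 0 /\
    (forall a b, K a + K b <= K (a + b)%nat) /\
    (forall n, Rpower 2 (K n - K (S n)) <= Rmax (d (S n)) ((1/2) ^ J)) /\
    (forall n, K n <= 8 / c * (1 - (1/2) ^ J) * INR n).
Proof.
intros Hc Hd Hsub J. induction J as [|J IH].
- exists (fun _ => 0). repeat split; intros; try lra.
  rewrite Rminus_0_r, Rpower_O by lra. apply Rmax_r.
- destruct IH as (K & K0 & Ksup & Kdiv & Klin).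
  assert (HJ : 0 < (1/2) ^ J) by (apply pow_lt; lra).
  set (h := (1/2) ^ J) in *.
  set (T := fun n : nat => (1 <= n)%nat /\ d n < h).
  assert (Hch : 0 < c / (2 * h)) by (apply Rdiv_lt_0_compat; lra).
  assert (Hgap : forall k x, (1 <= k)%nat -> d k < x -> x <= 2 * h -> c / (2 * h) <= INR k).
  { intros k x Hk Hx Hxh. specialize (Hd k Hk).
    assert (1 <= INR k) by (apply (le_INR 1); exact Hk).
    assert (E : c < x * INR k).
    { apply Rmult_lt_reg_r with (/ INR k); [apply Rinv_0_lt_compat; lra|].
      rewrite Rmult_assoc, Rinv_r, Rmult_1_r by lra. unfold Rdiv in Hd. lra. }
    assert (x * INR k <= 2 * h * INR k) by (apply Rmult_le_compat_r; lra).
    apply Rle_div_l; lra. }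
  destruct (superadditive_with_jumps (c / (2 * h)) T Hch) as (g & g0 & gsup & gmono & gjump & glin).
  { intros s [H1 H2]. apply (Hgap s h); lra || auto. }
  { intros s s' [H1 H2] [H3 H4] Hlt. rewrite <- minus_INR by lia.
    apply (Hgap (s' - s)%nat (2 * h)); [lia| |lra].
    specialize (Hsub s s' ltac:(lia)). lra. }
  exists (fun n => K n + g n). repeat split.
  + lra.
  + intros a b. specialize (Ksup a b). specialize (gsup a b). lra.
  + intros n. specialize (Kdiv n). specialize (gmono n). specialize (gjump n).
    change ((1/2) ^ S J) with (1/2 * h). cbv beta.
    destruct (Rlt_le_dec (d (S n)) h) as [L|L].
    * specialize (gjump (conj (le_n_S _ _ (Nat.le_0_l n)) L)).
      rewrite (Rmax_right (d (S n)) h) in Kdiv by lra.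
      apply Rle_trans with (2 := Rmax_r _ _).
      apply Rle_trans with (Rpower 2 (- (1) + (K n - K (S n)))).
      { apply Rle_Rpower; lra. }
      rewrite Rpower_plus, Rpower_Ropp, Rpower_1 by lra. lra.
    * rewrite (Rmax_left (d (S n)) h) in Kdiv by lra.
      apply Rle_trans with (2 := Rmax_l _ _).
      apply Rle_trans with (2 := Kdiv). apply Rle_Rpower; lra.
  + intros n. specialize (Klin n). specialize (glin n).
    change ((1/2) ^ S J) with (1/2 * h).
    replace (2 / (c / (2 * h))) with (8 / c * (1/2 * h)) in glin by (field; lra).
    replace (8 / c * (1 - 1/2 * h) * INR n)
      with (8 / c * (1 - h) * INR n + 8 / c * (1/2 * h) * INR n) by (field; lra).
    lra.
Qed.

(** Davie's device: weights that absorb the divisors one at a time and are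
    supermultiplicative, so that they pass through convolutions. *)
Lemma divisor_weights (d : nat -> R) (c : R) :
  0 < c ->
  (forall k, (1 <= k)%nat -> c / INR k <= d k) ->
  (forall m n, (m <= n)%nat -> d (n - m)%nat <= d n + d m) ->
  exists D : R, 0 < D /\ forall N : nat, exists W : nat -> R,
    W 0%nat = 1 /\
    (forall n, 0 < W n) /\
    (forall a b, W a * W b <= W (a + b)%nat) /\
    (forall n, (n < N)%nat -> W n <= W (S n) * d (S n) ^ 2) /\
    (forall n, W n <= D ^ n).
Proof.
intros Hc Hd Hsub. exists (Rpower 2 (16 / c)). split; [apply exp_pos|]. intros N.
assert (HJ : exists J, forall k, (1 <= k <= N)%nat -> (1/2) ^ J <= d k).
{ assert (HN : 0 < c / INR (S N)) by (apply Rdiv_lt_0_compat; [lra|apply lt_0_INR; lia]).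
  destruct (pow_lt_1_zero (1/2) ltac:(rewrite Rabs_pos_eq; lra) _ HN) as [J HJ].
  exists J. intros k Hk. specialize (HJ J (le_n _)).
  rewrite Rabs_pos_eq in HJ by (apply pow_le; lra).
  apply Rle_trans with (2 := Hd k ltac:(lia)). left. apply Rlt_le_trans with (1 := HJ).
  apply Rmult_le_compat_l; [lra|]. apply Rinv_le_contravar; [apply lt_0_INR; lia|].
  apply le_INR; lia. }
destruct HJ as [J HJ].
destruct (superadditive_for_divisors d c Hc Hd Hsub J) as (K & K0 & Ksup & Kdiv & Klin).
exists (fun n => Rpower 2 (2 * K n)). repeat split.
- rewrite K0, Rmult_0_r, Rpower_O; lra.
- intros n. apply exp_pos.
- intros a b. rewrite <- Rpower_plus. apply Rle_Rpower; [lra|]. specialize (Ksup a b). lra.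
- intros n Hn. specialize (Kdiv n). rewrite Rmax_left in Kdiv by (apply HJ; lia).
  replace (2 * K n) with (2 * K (S n) + ((K n - K (S n)) + (K n - K (S n)))) by ring.
  rewrite !Rpower_plus. apply Rmult_le_compat_l; [left; apply exp_pos|].
  assert (0 < Rpower 2 (K n - K (S n))) by apply exp_pos. simpl. nra.
- intros n. rewrite <- Rpower_pow by apply exp_pos. rewrite Rpower_mult.
  apply Rle_Rpower; [lra|]. specialize (Klin n).
  assert (0 < (1/2) ^ J) by (apply pow_lt; lra). assert (0 <= INR n) by apply pos_INR.
  assert (8 / c * (1 - (1/2) ^ J) * INR n <= 8 / c * INR n).
  { apply Rmult_le_compat_r; [assumption|]. assert (0 < 8 / c) by (apply Rdiv_lt_0_compat; lra). nra. }
  replace (16 / c * INR n) with (2 * (8 / c * INR n)) by (field; lra). lra.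
Qed.

(** * Series of complex numbers *)

(** Componentwise, so that the theorems on Cauchy products and dominated convergence
    of real series apply. *)
Definition Cseries (a : nat -> C) (l : C) : Prop :=
  is_series (fun k => fst (a k)) (fst l) /\ is_series (fun k => snd (a k)) (snd l).

Lemma fst_sum_n (a : nat -> C) n : fst (sum_n a n) = sum_n (fun k => fst (a k)) n.
Proof. induction n as [|n IH]; [now rewrite !sum_O|]. now rewrite !sum_Sn, <- IH. Qed.

Lemma snd_sum_n (a : nat -> C) n : snd (sum_n a n) = sum_n (fun k => snd (a k)) n.
Proof. induction n as [|n IH]; [now rewrite !sum_O|]. now rewrite !sum_Sn, <- IH. Qed.

Lemma sum_n_RtoC (a : nat -> R) n : sum_n (fun k => RtoC (a k)) n = RtoC (sum_n a n).
Proof.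
induction n as [|n IH]; [now rewrite !sum_O|]. rewrite !sum_Sn, IH. symmetry. apply RtoC_plus.
Qed.

Lemma Rabs_fst_le (z : C) : Rabs (fst z) <= Cmod z.
Proof. eapply Rle_trans; [apply Rmax_l|apply Rmax_Cmod]. Qed.

Lemma Rabs_snd_le (z : C) : Rabs (snd z) <= Cmod z.
Proof. eapply Rle_trans; [apply Rmax_r|apply Rmax_Cmod]. Qed.

Lemma Cmod_sum_n (a : nat -> C) n : Cmod (sum_n a n) <= sum_n (fun k => Cmod (a k)) n.
Proof.
induction n as [|n IH]; [rewrite !sum_O; lra|]. rewrite !sum_Sn.
eapply Rle_trans; [apply Cmod_triangle|]. unfold plus; simpl. lra.
Qed.

Lemma sum_n_C_mult_l (c : C) (a : nat -> C) n : sum_n (fun k => c * a k)%C n = (c * sum_n a n)%C.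
Proof.
induction n as [|n IH]; [now rewrite !sum_O|]. rewrite !sum_Sn, IH.
change (c * sum_n a n + c * a (S n) = c * (sum_n a n + a (S n)))%C. ring.
Qed.

Lemma sum_n_C_plus (a b : nat -> C) n :
  sum_n (fun k => a k + b k)%C n = (sum_n a n + sum_n b n)%C.
Proof. exact (sum_n_plus a b n). Qed.

Lemma sum_n_C_shift (a : nat -> C) n :
  sum_n a (S n) = (a O + sum_n (fun k => a (S k)) n)%C.
Proof.
induction n as [|n IH]; [now rewrite sum_Sn, !sum_O|].
rewrite sum_Sn, IH, sum_Sn.
change ((a O + sum_n (fun k => a (S k)) n) + a (S (S n))
  = a O + (sum_n (fun k => a (S k)) n + a (S (S n))))%C. ring.
Qed.

Lemma Cseries_unique a l l' : Cseries a l -> Cseries a l' -> l = l'.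
Proof.
intros [H1 H2] [H3 H4]. apply is_series_unique in H1, H2, H3, H4.
destruct l, l'. simpl in *. congruence.
Qed.

Lemma Cseries_ext a b l : (forall k, a k = b k) -> Cseries a l -> Cseries b l.
Proof.
intros H [H1 H2].
split; (eapply is_series_ext; [|eassumption]); intros k; cbv beta; now rewrite H.
Qed.

Lemma Cseries_plus a b l l' :
  Cseries a l -> Cseries b l' -> Cseries (fun k => a k + b k)%C (l + l')%C.
Proof. intros [H1 H2] [H3 H4]. split; now apply (is_series_plus (V := R_NormedModule)). Qed.

Lemma Cseries_mult_l c a l : Cseries a l -> Cseries (fun k => c * a k)%C (c * l)%C.
Proof.
intros [H1 H2]. destruct c as [c d]. split; simpl.
- apply (is_series_minus (V := R_NormedModule));
    now apply (is_series_scal (V := R_NormedModule)).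
- apply (is_series_plus (V := R_NormedModule));
    now apply (is_series_scal (V := R_NormedModule)).
Qed.

Lemma Cseries_incr_1 a l : a O = RtoC 0 -> Cseries a l -> Cseries (fun k => a (S k)) l.
Proof.
intros H0 [H1 H2].
split.
- apply (is_series_incr_1 (fun k => fst (a k))). rewrite H0.
  change (is_series (fun k => fst (a k)) (fst l + 0)). now rewrite Rplus_0_r.
- apply (is_series_incr_1 (fun k => snd (a k))). rewrite H0.
  change (is_series (fun k => snd (a k)) (snd l + 0)). now rewrite Rplus_0_r.
Qed.

Lemma ex_Cseries a : ex_series (fun k => Cmod (a k)) -> exists l, Cseries a l.
Proof.
intros H.
assert (H1 : ex_series (fun k => fst (a k))).
{ apply (ex_series_le (V := R_CompleteNormedModule)) with (2 := H).
  intros n. apply Rabs_fst_le. }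
assert (H2 : ex_series (fun k => snd (a k))).
{ apply (ex_series_le (V := R_CompleteNormedModule)) with (2 := H).
  intros n. apply Rabs_snd_le. }
exists (Series (fun k => fst (a k)), Series (fun k => snd (a k))).
split; now apply Series_correct.
Qed.

Lemma Cseries_is_series a l : Cseries a l -> @is_series C_AbsRing C_NormedModule a l.
Proof.
intros [H1 H2]. apply (proj2 (filterlim_locally _ _)). intros eps.
assert (L1 := proj1 (filterlim_locally _ _) H1 eps).
assert (L2 := proj1 (filterlim_locally _ _) H2 eps).
generalize (filter_and _ _ L1 L2). apply filter_imp. intros n [B1 B2].
split.
- rewrite fst_sum_n. exact B1.
- rewrite snd_sum_n. exact B2.
Qed.

Lemma is_series_R_ext (a b : nat -> R) (l : R) :
  (forall n, a n = b n) -> is_series a l -> is_series b l.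
Proof. apply is_series_ext. Qed.

Lemma is_series_lim_seq (a : nat -> R) (l : R) : is_series a l <-> is_lim_seq (sum_n a) l.
Proof. split; exact (fun H => H). Qed.

Lemma partial_sum_le (a : nat -> R) l n :
  (forall k, 0 <= a k) -> is_series a l -> sum_n a n <= l.
Proof.
intros H0 H. apply (is_lim_seq_incr_compare (sum_n a)); [exact H|].
intros k. rewrite sum_Sn. specialize (H0 (S k)). unfold plus; simpl. lra.
Qed.

Lemma sum_n_nonneg (a : nat -> R) n : (forall k, (k <= n)%nat -> 0 <= a k) -> 0 <= sum_n a n.
Proof.
induction n as [|n IH]; intros H; [rewrite sum_O; auto|].
rewrite sum_Sn. unfold plus; simpl.
assert (0 <= sum_n a n) by (apply IH; intros; apply H; lia).
specialize (H (S n) (le_n _)). lra.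
Qed.

Lemma sum_n_le_loc (a b : nat -> R) n :
  (forall k, (k <= n)%nat -> a k <= b k) -> sum_n a n <= sum_n b n.
Proof.
induction n as [|n IH]; intros H; [rewrite !sum_O; auto|].
rewrite !sum_Sn. unfold plus; simpl.
assert (sum_n a n <= sum_n b n) by (apply IH; intros; apply H; lia).
specialize (H (S n) (le_n _)). lra.
Qed.

Lemma sum_n_R_mult_l (c : R) (a : nat -> R) n : sum_n (fun k => c * a k) n = c * sum_n a n.
Proof. exact (sum_n_mult_l c a n). Qed.

Lemma sum_n_R_minus (a b : nat -> R) n : sum_n (fun k => a k - b k) n = sum_n a n - sum_n b n.
Proof.
induction n as [|n IH]; [now rewrite !sum_O|]. rewrite !sum_Sn, IH. unfold plus; simpl. lra.
Qed.

Lemma ex_series_bounded (a : nat -> R) B :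
  (forall k, 0 <= a k) -> (forall n, sum_n a n <= B) -> ex_series a.
Proof.
intros H0 HB. destruct (ex_finite_lim_seq_incr (sum_n a) B) as [l Hl]; [|exact HB|].
- intros n. rewrite sum_Sn. specialize (H0 (S n)). unfold plus; simpl. lra.
- exists l. exact Hl.
Qed.

Lemma is_series_trunc (h : nat -> R) N :
  is_series (fun n => if Nat.leb n N then h n else 0) (sum_n h N).
Proof.
apply is_series_lim_seq, (is_lim_seq_ext_loc (fun _ => sum_n h N)).
- exists N. induction 1 as [|m Hm IH].
  + apply sum_n_ext_loc. intros k Hk. apply Nat.leb_le in Hk. now rewrite Hk.
  + rewrite sum_Sn, <- IH. replace (Nat.leb (S m) N) with false.
    * unfold plus; simpl. lra.
    * symmetry. apply Nat.leb_gt. lia.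
- apply is_lim_seq_const.
Qed.

Lemma is_series_0 : is_series (fun _ : nat => 0) 0.
Proof.
apply is_series_lim_seq, (is_lim_seq_ext (fun _ => 0)); [|apply is_lim_seq_const].
intros n. rewrite sum_n_const. ring.
Qed.

(** ** Dominated convergence for series *)

(** [B + a] and [B - a] have nonnegative terms. *)
Lemma series_tail_le (a B : nat -> R) A b p :
  (forall n, Rabs (a n) <= B n) -> is_series a A -> is_series B b ->
  Rabs (A - sum_n a p) <= b - sum_n B p.
Proof.
intros H Ha Hb.
assert (Hp := partial_sum_le _ _ p (fun k => proj1 (Rminus_le_0 _ _)
  (Rle_trans _ _ _ (Rle_abs (a k)) (H k))) (is_series_minus B a b A Hb Ha)).
assert (Hm : sum_n (fun k => B k + a k) p <= b + A).
{ apply partial_sum_le; [|exact (is_series_plus B a b A Hb Ha)].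
  intros k. specialize (H k). apply Rabs_le_between in H. lra. }
assert (E1 := sum_n_R_minus B a p).
assert (E2 : sum_n (fun k => B k + a k) p = sum_n B p + sum_n a p) by exact (sum_n_plus B a p).
change (sum_n (fun k => B k - a k) p <= b - A) in Hp.
apply Rabs_le. lra.
Qed.

Lemma tannery (f : nat -> nat -> R) (F g B : nat -> R) (G : R) :
  (forall N, is_series (f N) (F N)) ->
  (forall N n, Rabs (f N n) <= B n) -> ex_series B ->
  (forall n, is_lim_seq (fun N => f N n) (g n)) -> is_series g G ->
  is_lim_seq F G.
Proof.
intros HF HB [b Hb] Hg HG.
assert (HBg : forall n, Rabs (g n) <= B n).
{ intros n. assert (L := is_lim_seq_abs _ _ (Hg n)).
  apply (is_lim_seq_le _ _ (Rabs (g n)) (B n) (fun N => HB N n) L), is_lim_seq_const. }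
apply is_lim_seq_spec. intros eps.
assert (Ht : exists p, b - sum_n B p < eps / 3).
{ assert (Hl : is_lim_seq (sum_n B) b) by exact Hb.
  apply is_lim_seq_spec in Hl.
  destruct (Hl (mkposreal (eps / 3) ltac:(destruct eps; simpl; lra))) as [p Hp].
  exists p. specialize (Hp p (le_n _)). simpl in Hp. apply Rabs_lt_between in Hp. lra. }
destruct Ht as [p Hp].
assert (Hs : is_lim_seq (fun N => sum_n (f N) p) (sum_n g p)).
{ clear - Hg. induction p as [|p IH].
  - rewrite sum_O. apply (is_lim_seq_ext (fun N => f N O)); [|apply Hg].
    intros N. now rewrite sum_O.
  - rewrite sum_Sn. apply (is_lim_seq_ext (fun N => sum_n (f N) p + f N (S p))).
    + intros N. now rewrite sum_Sn.
    + now apply is_lim_seq_plus'. }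
apply is_lim_seq_spec in Hs.
destruct (Hs (mkposreal (eps / 3) ltac:(destruct eps; simpl; lra))) as [N0 HN0].
exists N0. intros N HN. specialize (HN0 N HN). simpl in HN0.
assert (T1 := series_tail_le _ _ _ _ p (HB N) (HF N) Hb).
assert (T2 := series_tail_le _ _ _ _ p HBg HG Hb).
apply Rabs_le_between in T1, T2. apply Rabs_lt_between in HN0. apply Rabs_lt_between. lra.
Qed.

(** ** Products and the exponential *)

Lemma Cseries_mult a b A B :
  Cseries a A -> Cseries b B ->
  ex_series (fun k => Cmod (a k)) -> ex_series (fun k => Cmod (b k)) ->
  Cseries (fps_mul a b) (A * B)%C.
Proof.
intros [Ha1 Ha2] [Hb1 Hb2] Ma Mb.
assert (D : forall (c : nat -> C), ex_series (fun k => Cmod (c k)) ->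
  ex_series (fun k => Rabs (fst (c k))) /\ ex_series (fun k => Rabs (snd (c k)))).
{ intros c Hc. split; apply (ex_series_le (V := R_CompleteNormedModule)) with (2 := Hc);
    intros n; unfold norm; simpl; unfold abs; simpl; rewrite Rabs_Rabsolu;
    [apply Rabs_fst_le|apply Rabs_snd_le]. }
destruct (D a Ma) as [Da1 Da2]. destruct (D b Mb) as [Db1 Db2].
split.
- eapply is_series_R_ext; [|apply (is_series_minus (V := R_NormedModule) _ _ _ _
    (is_series_mult _ _ _ _ Ha1 Hb1 Da1 Db1) (is_series_mult _ _ _ _ Ha2 Hb2 Da2 Db2))].
  intros n. cbv beta. unfold fps_mul. rewrite fst_sum_n, <- !sum_n_Reals.
  symmetry. apply sum_n_R_minus.
- eapply is_series_R_ext; [|apply (is_series_plus (V := R_NormedModule) _ _ _ _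
    (is_series_mult _ _ _ _ Ha1 Hb2 Da1 Db2) (is_series_mult _ _ _ _ Ha2 Hb1 Da2 Db1))].
  intros n. cbv beta. unfold fps_mul. rewrite snd_sum_n, <- !sum_n_Reals.
  symmetry. apply (sum_n_plus (G := R_AbelianMonoid)).
Qed.

Definition exp_term (z : C) (n : nat) : C := (z ^ n / RtoC (INR (fact n)))%C.

Lemma INR_fact_C_neq_0 n : RtoC (INR (fact n)) <> RtoC 0.
Proof. intros E. apply RtoC_inj in E. now apply INR_fact_neq_0 in E. Qed.

Lemma exp_term_S z n : (RtoC (INR (S n)) * exp_term z (S n) = z * exp_term z n)%C.
Proof.
unfold exp_term. rewrite fact_simpl, mult_INR, RtoC_mult. cbn [Cpow].
field. split; [apply INR_fact_C_neq_0|].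
intros E. apply RtoC_inj in E. now apply not_0_INR in E.
Qed.

(** Both sides satisfy [(n + 1) p_(n+1) = (z + w) p_n], the left one by the
    Leibniz rule. *)
Lemma exp_term_add z w n : fps_mul (exp_term z) (exp_term w) n = exp_term (z + w) n.
Proof.
induction n as [|n IH].
- unfold fps_mul, exp_term. rewrite sum_O. cbn. field.
- assert (HS : RtoC (INR (S n)) <> RtoC 0).
  { intros E. apply RtoC_inj in E. now apply not_0_INR in E. }
  enough (E : (RtoC (INR (S n)) * fps_mul (exp_term z) (exp_term w) (S n)
    = RtoC (INR (S n)) * exp_term (z + w) (S n))%C).
  { rewrite <- (Cmult_1_l (fps_mul _ _ _)), <- (Cinv_l _ HS), <- Cmult_assoc, E. field. exact HS. }
  rewrite exp_term_S, <- IH.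
  set (a := exp_term z). set (b := exp_term w).
  assert (Ha : forall i, (RtoC (INR (S i)) * a (S i) = z * a i)%C) by apply exp_term_S.
  assert (Hb : forall i, (RtoC (INR (S i)) * b (S i) = w * b i)%C) by apply exp_term_S.
  unfold fps_mul. rewrite <- sum_n_C_mult_l.
  rewrite (sum_n_C_ext _ (fun i => (RtoC (INR i) * a i) * b (S n - i)%nat
    + a i * (RtoC (INR (S n - i)) * b (S n - i)%nat))%C).
  2:{ intros i Hi. rewrite (minus_INR (S n) i Hi), RtoC_minus. ring. }
  rewrite sum_n_C_plus, sum_n_C_shift. rewrite (sum_Sn _ n), Nat.sub_diag.
  change (RtoC (INR 0)) with (RtoC 0).
  change (plus ?x ?y) with (x + y)%C.
  rewrite !Cmult_0_l, Cmult_0_r, Cplus_0_l, Cplus_0_r, <- sum_n_C_plus, <- sum_n_C_mult_l.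
  apply sum_n_C_ext. intros i Hi. rewrite Ha.
  replace (S n - S i)%nat with (n - i)%nat by lia.
  replace (S n - i)%nat with (S (n - i)) by lia. rewrite Hb. ring.
Qed.

Lemma Cmod_exp_term z n : Cmod (exp_term z n) = Cmod z ^ n / INR (fact n).
Proof.
unfold exp_term. rewrite Cmod_div by apply INR_fact_C_neq_0.
rewrite Cmod_pow, Cmod_R, Rabs_pos_eq; [reflexivity|apply pos_INR].
Qed.

Lemma is_series_exp (x : R) : is_series (fun n => x ^ n / INR (fact n)) (exp x).
Proof.
assert (H := is_exp_Reals x). apply is_pseries_R in H.
eapply is_series_R_ext; [|exact H]. intros n. apply Rmult_comm.
Qed.

Lemma ex_series_exp_term z : ex_series (fun n => Cmod (exp_term z n)).
Proof.
exists (exp (Cmod z)). eapply is_series_R_ext; [|apply is_series_exp].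
intros n. symmetry. apply Cmod_exp_term.
Qed.

Lemma Cexp_RtoC x : Cexp (RtoC x) = RtoC (exp x).
Proof. unfold Cexp, RtoC; simpl. rewrite cos_0, sin_0. f_equal; ring. Qed.

Lemma exp_term_RtoC x n : exp_term (RtoC x) n = RtoC (x ^ n / INR (fact n)).
Proof.
unfold exp_term. rewrite RtoC_div by apply INR_fact_neq_0. now rewrite RtoC_pow.
Qed.

Lemma Cseries_exp_RtoC x : Cseries (exp_term (RtoC x)) (Cexp (RtoC x)).
Proof.
rewrite Cexp_RtoC. split.
- change (fst (RtoC (exp x))) with (exp x). eapply is_series_R_ext; [|apply is_series_exp]. intros n. now rewrite exp_term_RtoC.
- change (snd (RtoC (exp x))) with 0. eapply is_series_R_ext; [|apply is_series_0].
  intros n. now rewrite exp_term_RtoC.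
Qed.

Lemma Cpow_Ci_even k : (Ci ^ (2 * k))%C = RtoC ((-1) ^ k).
Proof.
rewrite Cpow_mult_r, RtoC_pow. f_equal. simpl. unfold Ci, Cmult, RtoC; simpl. f_equal; ring.
Qed.

Lemma Cexp_imag (t : R) : Cexp (Ci * RtoC t) = (cos t, sin t).
Proof.
unfold Cexp, Ci, Cmult, RtoC; simpl.
replace (0 * t - 1 * 0) with 0 by ring. replace (0 * 0 + 1 * t) with t by ring.
rewrite exp_0. f_equal; ring.
Qed.

(** The even and odd terms are the series of the cosine and the sine; this is
    read off on both components [h] at once. *)
Lemma Cseries_exp_imag b : Cseries (exp_term (Ci * RtoC b)) (Cexp (Ci * RtoC b)).
Proof.
assert (E : forall n, exp_term (Ci * RtoC b) n
  = (Ci ^ n * RtoC (/ INR (fact n) * b ^ n))%C).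
{ intros n. unfold exp_term. rewrite Cpow_mult_l, RtoC_mult, RtoC_inv, RtoC_pow
    by apply INR_fact_neq_0.
  unfold Cdiv. ring. }
rewrite Cexp_imag.
assert (P : forall (h : C -> R), (forall z r, h (z * RtoC r)%C = h z * r) -> forall x1 x2,
  is_pseries (fun k => h (Ci ^ (2 * k))%C * / INR (fact (2 * k))) (b ^ 2) x1 ->
  is_pseries (fun k => h (Ci ^ (2 * k + 1))%C * / INR (fact (2 * k + 1))) (b ^ 2) x2 ->
  is_series (fun n => h (exp_term (Ci * RtoC b) n)) (x1 + b * x2)).
{ intros h Hh x1 x2 H1 H2.
  assert (Q := is_pseries_odd_even (fun n => h (Ci ^ n)%C * / INR (fact n)) b x1 x2 H1 H2).
  apply is_pseries_R in Q. eapply is_series_R_ext; [|exact Q].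
  intros n. cbv beta. rewrite E, Hh. ring. }
assert (Z0 : forall a x, (forall n, a n = 0) -> is_pseries a x 0).
{ intros a x Ha. apply is_pseries_R. eapply is_series_R_ext; [|apply is_series_0].
  intros n. cbv beta. rewrite Ha. ring. }
split; [change (fst (cos b, sin b)) with (cos b)|change (snd (cos b, sin b)) with (sin b)].
- replace (cos b) with (cos b + b * 0) by ring. apply P.
  + intros [u v] r. simpl. ring.
  + apply is_pseries_R. unfold cos. destruct (exist_cos (Rsqr b)) as [l Hl].
    apply is_series_Reals in Hl. eapply is_series_R_ext; [|exact Hl].
    intros n. cbv beta. rewrite Cpow_Ci_even. unfold cos_n, Rsqr, Rdiv. simpl fst.
    replace (b ^ 2) with (b * b) by ring. reflexivity.
  + apply Z0. intros n.
    rewrite Cpow_add_r, Cpow_1_r, Cpow_Ci_even. simpl fst. ring.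
- unfold sin. destruct (exist_sin (Rsqr b)) as [l Hl].
  replace (b * l) with (0 + b * l) by ring. apply P.
  + intros [u v] r. simpl. ring.
  + apply Z0. intros n.
    rewrite Cpow_Ci_even. simpl snd. ring.
  + apply is_pseries_R. apply is_series_Reals in Hl. eapply is_series_R_ext; [|exact Hl].
    intros n. cbv beta. rewrite Cpow_add_r, Cpow_1_r, Cpow_Ci_even. unfold sin_n, Rsqr, Rdiv.
    replace (b ^ 2) with (b * b) by ring. simpl snd. ring.
Qed.

Lemma Cseries_exp z : Cseries (exp_term z) (Cexp z).
Proof.
replace z with (RtoC (fst z) + Ci * RtoC (snd z))%C.
2:{ destruct z as [a b]. unfold Ci, Cmult, Cplus, RtoC; simpl. f_equal; ring. }
rewrite Cexp_add. eapply Cseries_ext; [apply exp_term_add|].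
apply Cseries_mult.
- apply Cseries_exp_RtoC.
- apply Cseries_exp_imag.
- apply ex_series_exp_term.
- apply ex_series_exp_term.
Qed.

(** * Real formal power series as majorants *)

(** Real counterparts of the formal operations: they agree with the complex ones
    on real series and majorize them on absolute values. *)
Definition rfps_mul (a b : nat -> R) (k : nat) : R := sum_n (fun i => a i * b (k - i)%nat) k.

Fixpoint rfps_pow (a : nat -> R) (n : nat) : nat -> R :=
  match n with
  | O => fun k => match k with O => 1 | S _ => 0 end
  | S n' => rfps_mul a (rfps_pow a n')
  end.

Definition rfps_exp (a : nat -> R) (k : nat) : R :=
  sum_n (fun n => rfps_pow a n k / INR (fact n)) k.

Lemma rfps_pow_nonneg a n k :
  (forall j, (j <= k)%nat -> 0 <= a j) -> 0 <= rfps_pow a n k.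
Proof.
revert k; induction n as [|n IH]; intros k H; simpl.
- destruct k; lra.
- apply sum_n_nonneg. intros i Hi. apply Rmult_le_pos; [now apply H|].
  apply IH. intros j Hj. apply H. lia.
Qed.

Lemma fps_pow_RtoC (b : nat -> R) n k :
  fps_pow (fun j => RtoC (b j)) n k = RtoC (rfps_pow b n k).
Proof.
revert k; induction n as [|n IH]; intros k; simpl; [now destruct k|].
unfold fps_mul, rfps_mul. rewrite <- sum_n_RtoC. apply sum_n_C_ext.
intros i Hi. now rewrite IH, RtoC_mult.
Qed.

Lemma fps_exp_RtoC (b : nat -> R) k :
  fps_exp (fun j => RtoC (b j)) k = RtoC (rfps_exp b k).
Proof.
unfold fps_exp, rfps_exp. rewrite <- sum_n_RtoC. apply sum_n_C_ext.
intros i Hi. now rewrite fps_pow_RtoC, RtoC_div by apply INR_fact_neq_0.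
Qed.

Lemma Cmod_fps_pow a n k : Cmod (fps_pow a n k) <= rfps_pow (fun j => Cmod (a j)) n k.
Proof.
revert k; induction n as [|n IH]; intros k; simpl.
- destruct k; [rewrite Cmod_1|rewrite Cmod_0]; lra.
- eapply Rle_trans; [apply Cmod_sum_n|]. apply sum_n_le_loc. intros i Hi.
  rewrite Cmod_mult. apply Rmult_le_compat_l; [apply Cmod_ge_0|apply IH].
Qed.

Lemma fps_pow_low_degree a n k : a O = RtoC 0 -> (k < n)%nat -> fps_pow a n k = RtoC 0.
Proof.
intros H0. revert k; induction n as [|n IH]; intros k Hk; [lia|]. simpl.
unfold fps_mul. transitivity (sum_n (fun i => RtoC 0) k).
- apply sum_n_C_ext. intros [|i] Hi; [rewrite H0; ring|]. rewrite IH by lia. ring.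
- rewrite sum_n_RtoC, sum_n_const. f_equal. ring.
Qed.

Lemma is_series_rfps_pow a Q n :
  (forall k, 0 <= a k) -> is_series a Q -> is_series (rfps_pow a n) (Q ^ n).
Proof.
intros H0 H. induction n as [|n IH].
- apply (is_series_R_ext (fun k => if Nat.leb k 0 then 1 else 0)); [now intros [|k]|].
  replace (Q ^ 0) with (sum_n (fun _ => 1) 0) by (rewrite sum_O; reflexivity). apply is_series_trunc.
- eapply is_series_R_ext; [|apply (is_series_mult_pos _ _ _ _ H IH H0)].
  + intros k. cbv beta. now rewrite <- sum_n_Reals.
  + intros k. now apply rfps_pow_nonneg.
Qed.

Lemma ex_series_fps_pow a n :
  ex_series (fun k => Cmod (a k)) -> ex_series (fun k => Cmod (fps_pow a n k)).
Proof.
intros [Q HQ].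
apply (ex_series_le (V := R_CompleteNormedModule)) with (rfps_pow (fun k => Cmod (a k)) n).
- intros k. unfold norm; simpl; unfold abs; simpl. rewrite Rabs_pos_eq by apply Cmod_ge_0.
  apply Cmod_fps_pow.
- exists (Q ^ n). apply is_series_rfps_pow; [intros; apply Cmod_ge_0|exact HQ].
Qed.

Lemma Cseries_fps_pow a S n : ex_series (fun k => Cmod (a k)) -> Cseries a S ->
  Cseries (fps_pow a n) (S ^ n)%C.
Proof.
intros Ha HS. induction n as [|n IH].
- split; (eapply is_series_R_ext;
    [|match goal with |- is_series _ ?l =>
        replace l with (sum_n (fun _ : nat => l) 0) by (rewrite sum_O; reflexivity) end; apply is_series_trunc]);
    now intros [|k].
- apply Cseries_mult; auto. now apply ex_series_fps_pow.
Qed.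

(** The double series [sum_n sum_k (a^n)_k / n!] converges absolutely, because
    the one of the absolute values sums to [exp (sum |a_k|)]; summing it over
    [n] for each degree [k] gives the coefficients of the formal exponential. *)
Lemma Cseries_fps_exp a S : a O = RtoC 0 -> ex_series (fun k => Cmod (a k)) ->
  Cseries a S -> Cseries (fps_exp a) (Cexp S).
Proof.
intros H0 Ha HS.
pose (T := fun N n => sum_n (fun k => fps_pow a n k / RtoC (INR (fact n)))%C N).
assert (Hpart : forall N, sum_n (fps_exp a) N = sum_n (fun n => T N n) N).
{ intros N. unfold T.
  rewrite (sum_n_switch (fun n k => fps_pow a n k / RtoC (INR (fact n)))%C N N).
  apply sum_n_C_ext. intros k Hk. unfold fps_exp.
  replace N with (k + (N - k))%nat by lia. generalize (N - k)%nat. intros p.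
  induction p as [|p IH]; [now rewrite Nat.add_0_r|].
  rewrite Nat.add_succ_r, sum_Sn, <- IH, fps_pow_low_degree by (assumption || lia).
  unfold Cdiv. rewrite Cmult_0_l. symmetry. apply Cplus_0_r. }
assert (Hlim : forall n, Cseries (fun k => fps_pow a n k / RtoC (INR (fact n)))%C (exp_term S n)).
{ intros n. apply (Cseries_ext (fun k => / RtoC (INR (fact n)) * fps_pow a n k)%C).
  - intros k. apply Cmult_comm.
  - unfold exp_term, Cdiv. rewrite Cmult_comm. apply Cseries_mult_l. now apply Cseries_fps_pow. }
destruct Ha as [Q HQ].
assert (Hb : forall N n, Cmod (T N n) <= Q ^ n / INR (fact n)).
{ intros N n. eapply Rle_trans; [apply Cmod_sum_n|].
  apply Rle_trans with (sum_n (fun k => / INR (fact n) * rfps_pow (fun j => Cmod (a j)) n k) N).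
  - apply sum_n_le_loc. intros k _.
    rewrite Cmod_div, Cmod_R, Rabs_pos_eq by (apply pos_INR || apply INR_fact_C_neq_0).
    unfold Rdiv. rewrite Rmult_comm. apply Rmult_le_compat_l; [|apply Cmod_fps_pow].
    left. apply Rinv_0_lt_compat, INR_fact_lt_0.
  - rewrite sum_n_R_mult_l. unfold Rdiv. rewrite Rmult_comm. apply Rmult_le_compat_r.
    + left. apply Rinv_0_lt_compat, INR_fact_lt_0.
    + apply partial_sum_le; [intros k; apply rfps_pow_nonneg; intros; apply Cmod_ge_0|].
      apply is_series_rfps_pow; [intros; apply Cmod_ge_0|exact HQ]. }
assert (HB : ex_series (fun n => Q ^ n / INR (fact n))) by (exists (exp Q); apply is_series_exp).
assert (Hcomp : forall h : C -> R,
  (forall z, Rabs (h z) <= Cmod z) ->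
  (forall b N, h (sum_n b N) = sum_n (fun k => h (b k)) N) ->
  (forall b l, Cseries b l -> is_series (fun k => h (b k)) (h l)) ->
  is_series (fun k => h (fps_exp a k)) (h (Cexp S))).
{ intros h Hh Hsum Hser. apply is_series_lim_seq.
  apply (tannery (fun N n => if Nat.leb n N then h (T N n) else 0) _
    (fun n => h (exp_term S n)) (fun n => Q ^ n / INR (fact n))).
  - intros N. rewrite <- Hsum, Hpart, Hsum. apply is_series_trunc.
  - intros N n. destruct (Nat.leb n N).
    + eapply Rle_trans; [apply Hh|apply Hb].
    + rewrite Rabs_R0. eapply Rle_trans; [apply Cmod_ge_0|apply (Hb N n)].
  - exact HB.
  - intros n. apply (is_lim_seq_ext_loc (fun N => h (T N n))).
    + exists n. intros N HN. apply Nat.leb_le in HN. now rewrite HN.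
    + unfold T. eapply is_lim_seq_ext; [intros N; symmetry; apply Hsum|].
      apply is_series_lim_seq, Hser, Hlim.
  - apply Hser, Cseries_exp. }
split; apply Hcomp; auto using Rabs_fst_le, Rabs_snd_le, fst_sum_n, snd_sum_n;
  intros b l [H1 H2]; assumption.
Qed.

Lemma is_series_rfps_exp a s : a O = 0 -> (forall k, 0 <= a k) -> is_series a s ->
  is_series (rfps_exp a) (exp s).
Proof.
intros H0 Hp H.
assert (E : Cseries (fps_exp (fun k => RtoC (a k))) (Cexp (RtoC s))).
{ apply Cseries_fps_exp.
  - now rewrite H0.
  - exists s. eapply is_series_R_ext; [|exact H]. intros k. cbv beta.
    now rewrite Cmod_R, Rabs_pos_eq.
  - split; [exact H|apply is_series_0]. }
rewrite Cexp_RtoC in E. destruct E as [E _].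
eapply is_series_R_ext; [|exact E]. intros k. cbv beta. now rewrite fps_exp_RtoC.
Qed.

Lemma rfps_exp_nonneg a k : (forall j, (j <= k)%nat -> 0 <= a j) -> 0 <= rfps_exp a k.
Proof.
intros H. apply sum_n_nonneg. intros n _. apply Rdiv_le_0_compat; [|apply INR_fact_lt_0].
now apply rfps_pow_nonneg.
Qed.

Lemma rfps_exp_ext a b k : (forall j, (j <= k)%nat -> a j = b j) -> rfps_exp a k = rfps_exp b k.
Proof.
intros H. apply RtoC_inj. rewrite <- !fps_exp_RtoC.
unfold fps_exp. apply sum_n_C_ext. intros n _. f_equal.
apply (fps_pow_ext _ _ k); [|apply le_n]. intros j Hj. now rewrite H.
Qed.

(** Truncating [a] after degree [N] changes neither side, and for the truncated
    series the right-hand side is the complete sum of the exponential. *)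
Lemma rfps_exp_partial_sum a N : a O = 0 -> (forall k, 0 <= a k) ->
  sum_n (rfps_exp a) N <= exp (sum_n a N).
Proof.
intros H0 Hp. set (b := fun k => if Nat.leb k N then a k else 0).
assert (Hb : forall k, 0 <= b k) by (intros k; unfold b; destruct (Nat.leb k N); [apply Hp|lra]).
rewrite (sum_n_ext_loc _ (rfps_exp b)).
- apply partial_sum_le; [intros k; now apply rfps_exp_nonneg|].
  apply is_series_rfps_exp; [exact H0|exact Hb|apply is_series_trunc].
- intros k Hk. apply rfps_exp_ext. intros j Hj. unfold b.
  replace (Nat.leb j N) with true; [reflexivity|]. symmetry. apply Nat.leb_le. lia.
Qed.

(** ** Compatibility with weights *)

Lemma rfps_pow_weight (W mu : nat -> R) n k :
  W O = 1 -> (forall j, 0 < W j) -> (forall i j, W i * W j <= W (i + j)%nat) ->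
  (forall j, (j <= k)%nat -> 0 <= mu j) ->
  rfps_pow (fun j => W j * mu j) n k <= W k * rfps_pow mu n k.
Proof.
intros W0 Wp Ws. revert k; induction n as [|n IH]; intros k Hmu; simpl.
- destruct k; [rewrite W0; lra|lra].
- unfold rfps_mul. rewrite <- sum_n_R_mult_l. apply sum_n_le_loc. intros i Hi.
  assert (IHi := IH (k - i)%nat ltac:(intros; apply Hmu; lia)).
  assert (Hi0 := Hmu i Hi). assert (Wi := Wp i).
  assert (P0 : 0 <= rfps_pow mu n (k - i)) by (apply rfps_pow_nonneg; intros; apply Hmu; lia).
  assert (Wik := Ws i (k - i)%nat). replace (i + (k - i))%nat with k in Wik by lia.
  apply Rle_trans with (W i * mu i * (W (k - i)%nat * rfps_pow mu n (k - i))).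
  + apply Rmult_le_compat_l; [|exact IHi]. apply Rmult_le_pos; lra.
  + replace (W i * mu i * (W (k - i)%nat * rfps_pow mu n (k - i)))
      with (W i * W (k - i)%nat * (mu i * rfps_pow mu n (k - i))) by ring.
    apply Rmult_le_compat_r; [now apply Rmult_le_pos|exact Wik].
Qed.

(** Supermultiplicative weights pull out of every convolution. *)
Lemma rfps_exp_weight (W mu : nat -> R) k :
  W O = 1 -> (forall j, 0 < W j) -> (forall i j, W i * W j <= W (i + j)%nat) ->
  (forall j, (j <= k)%nat -> 0 <= mu j) ->
  rfps_exp (fun j => W j * mu j) k <= W k * rfps_exp mu k.
Proof.
intros W0 Wp Ws Hmu. unfold rfps_exp. rewrite <- sum_n_R_mult_l.
apply sum_n_le_loc. intros n _. unfold Rdiv. rewrite <- Rmult_assoc.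
apply Rmult_le_compat_r; [left; apply Rinv_0_lt_compat, INR_fact_lt_0|].
now apply rfps_pow_weight.
Qed.

Lemma fps_pow_dilate c a n k : fps_pow (fps_dilate c a) n k = fps_dilate c (fps_pow a n) k.
Proof.
revert k; induction n as [|n IH]; intros k; unfold fps_dilate; simpl.
- destruct k; simpl; ring.
- unfold fps_mul. rewrite <- sum_n_C_mult_l. apply sum_n_C_ext. intros i Hi.
  rewrite IH. unfold fps_dilate.
  replace (c ^ k)%C with (c ^ i * c ^ (k - i))%C by (rewrite <- Cpow_add_r; f_equal; lia). ring.
Qed.

Lemma fps_exp_dilate c a k : fps_exp (fps_dilate c a) k = fps_dilate c (fps_exp a) k.
Proof.
unfold fps_dilate at 2. unfold fps_exp. rewrite <- sum_n_C_mult_l. apply sum_n_C_ext.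
intros n _. rewrite fps_pow_dilate. unfold fps_dilate, Cdiv. ring.
Qed.

Lemma rfps_exp_dilate x a k : rfps_exp (fun j => x ^ j * a j) k = x ^ k * rfps_exp a k.
Proof.
apply RtoC_inj. rewrite RtoC_mult, <- !fps_exp_RtoC, RtoC_pow.
transitivity (fps_dilate (RtoC x) (fps_exp (fun j => RtoC (a j))) k); [|reflexivity].
rewrite <- fps_exp_dilate.
unfold fps_exp. apply sum_n_C_ext. intros n _. f_equal.
apply (fps_pow_ext _ _ k); [|apply le_n]. intros j _. unfold fps_dilate.
now rewrite RtoC_mult, RtoC_pow.
Qed.

(** * The coefficients of [m] *)

Lemma Cmod_Cexp_imag (t : R) : Cmod (Cexp (Ci * RtoC t)) = 1.
Proof.
rewrite Cexp_imag. unfold Cmod; simpl. rewrite !Rmult_1_r.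
assert (H := sin2_cos2 t). unfold Rsqr in H. rewrite Rplus_comm, H. apply sqrt_1.
Qed.

Lemma small_divisor_sin alpha k :
  small_divisor alpha k = RtoC (- (4 * divisor alpha k ^ 2)).
Proof.
unfold small_divisor. rewrite Cpow_inv by apply Cexp_neq_0. rewrite lambda_pow.
set (t := 2 * PI * alpha * INR k).
replace (/ Cexp (Ci * RtoC t))%C with (Cexp (- (Ci * RtoC t))).
2:{ assert (H := Cexp_neq_0 (Ci * RtoC t)).
    rewrite <- (Cmult_1_r (Cexp (- _))), <- (Cinv_r _ H), Cmult_assoc, Cexp_opp_l. ring. }
replace (- (Ci * RtoC t))%C with (Ci * RtoC (- t))%C by (rewrite RtoC_opp; ring).
rewrite !Cexp_imag, cos_neg, sin_neg. unfold divisor. rewrite pow2_abs.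
unfold t. replace (2 * PI * alpha * INR k) with (2 * (PI * (INR k * alpha))) by ring.
rewrite cos_2a_sin. unfold Cplus, Cminus, Copp, RtoC; simpl. f_equal; ring.
Qed.

Definition m_real (alpha : R) (k : nat) : R := fst (m_coef alpha k).

Lemma divisor_pos alpha k : irrational alpha -> (k <> 0)%nat -> 0 < divisor alpha k.
Proof.
intros Ha Hk. assert (H := small_divisor_neq_0 alpha k Ha Hk). rewrite small_divisor_sin in H.
destruct (Rabs_pos (sin (PI * (INR k * alpha)))) as [L|L]; [exact L|].
exfalso. apply H. unfold divisor. rewrite <- L. f_equal. ring.
Qed.

Lemma m_coef_real_rec alpha : irrational alpha -> forall k,
  m_coef alpha k = RtoC (m_real alpha k) /\ 0 <= m_real alpha k.
Proof.
intros Ha. assert (Hm := m_coef_solution alpha Ha).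
rewrite formal_solution_step in Hm by exact Ha.
intros k; induction k as [k IH] using (well_founded_induction lt_wf).
destruct k as [|k].
- unfold m_real. rewrite (Hm O). simpl. split; [reflexivity|lra].
- assert (E : m_coef alpha (S k)
    = RtoC (rfps_exp (m_real alpha) k / (4 * divisor alpha (S k) ^ 2))).
  { rewrite (Hm (S k)). unfold solution_step.
    rewrite (fps_mulX_exp_ext _ (fun j => RtoC (m_real alpha j)) (S k))
      by (intros j Hj; apply IH; exact Hj).
    simpl fps_mulX. rewrite fps_exp_RtoC, small_divisor_sin.
    assert (D := divisor_pos alpha (S k) Ha ltac:(lia)).
    assert (0 < divisor alpha (S k) ^ 2) by now apply pow_lt.
    rewrite <- RtoC_opp, <- RtoC_div by lra. f_equal. field. lra. }
  assert (E' : m_real alpha (S k) = rfps_exp (m_real alpha) k / (4 * divisor alpha (S k) ^ 2))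
    by (unfold m_real at 1; rewrite E; reflexivity).
  rewrite E'. split; [exact E|]. apply Rdiv_le_0_compat.
  + apply rfps_exp_nonneg. intros j Hj. apply IH. lia.
  + assert (D := divisor_pos alpha (S k) Ha ltac:(lia)).
    assert (0 < divisor alpha (S k) ^ 2) by now apply pow_lt. lra.
Qed.

Lemma m_coef_real alpha k : irrational alpha -> m_coef alpha k = RtoC (m_real alpha k).
Proof. intros Ha. now apply m_coef_real_rec. Qed.

Lemma m_real_nonneg alpha k : irrational alpha -> 0 <= m_real alpha k.
Proof. intros Ha. now apply m_coef_real_rec. Qed.

Lemma m_real_0 alpha : irrational alpha -> m_real alpha 0 = 0.
Proof. intros Ha. unfold m_real. now rewrite (proj1 (m_coef_solution alpha Ha)). Qed.

Lemma m_real_S alpha k : irrational alpha ->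
  4 * divisor alpha (S k) ^ 2 * m_real alpha (S k) = rfps_exp (m_real alpha) k.
Proof.
intros Ha. apply RtoC_inj. rewrite RtoC_mult, <- (m_coef_real alpha) by exact Ha.
replace (4 * divisor alpha (S k) ^ 2) with (- - (4 * divisor alpha (S k) ^ 2)) by ring.
rewrite RtoC_opp, <- small_divisor_sin.
assert (Hm := m_coef_solution alpha Ha).
rewrite formal_solution_step in Hm by exact Ha. rewrite (Hm (S k)). unfold solution_step.
assert (D := small_divisor_neq_0 alpha (S k) Ha ltac:(lia)).
rewrite (fps_mulX_exp_ext _ (fun j => RtoC (m_real alpha j)) (S k))
  by (intros; now apply m_coef_real).
simpl fps_mulX. rewrite fps_exp_RtoC. field. exact D.
Qed.

Lemma m_real_1_pos alpha : irrational alpha -> 0 < m_real alpha 1.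
Proof.
intros Ha. destruct (m_real_nonneg alpha 1 Ha) as [L|L]; [exact L|exfalso].
assert (E := m_real_S alpha 0 Ha). rewrite <- L in E.
unfold rfps_exp in E. rewrite sum_O in E. simpl in E. lra.
Qed.

(** The quotients [mu_k] of the coefficients by the weights satisfy
    [mu_(k+1) <= [x^k] exp mu]: the divisors have disappeared.  At [x = 1 / e]
    the partial sums [s] of [sum mu_k x^k] then obey [s' <= x e^s], which keeps
    them below 1. *)
Lemma m_real_geometric_bound alpha : bounded_type alpha ->
  exists D, 0 < D /\ forall k, m_real alpha k <= D ^ k.
Proof.
intros H. assert (Ha := proj1 H).
destruct (divisor_lower_bound alpha H) as [c [Hc Hd]].
destruct (divisor_weights (divisor alpha) c Hc Hd (divisor_sub alpha)) as (D & HD & HW).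
exists (D * exp 1). split; [apply Rmult_lt_0_compat; [exact HD|apply exp_pos]|].
intros N. destruct (HW N) as (W & W0 & Wp & Ws & Wd & WD).
set (mu := fun k => m_real alpha k / W k).
assert (Hmu0 : forall k, 0 <= mu k).
{ intros k. apply Rdiv_le_0_compat; [now apply m_real_nonneg|apply Wp]. }
assert (HmuW : forall k, m_real alpha k = W k * mu k).
{ intros k. unfold mu. specialize (Wp k). field. lra. }
assert (Hrec : forall k, (k < N)%nat -> mu (S k) <= rfps_exp mu k).
{ intros k Hk. assert (E := m_real_S alpha k Ha).
  rewrite (rfps_exp_ext _ (fun j => W j * mu j) k) in E by (intros; apply HmuW).
  assert (L := rfps_exp_weight W mu k W0 Wp Ws (fun j _ => Hmu0 j)).
  rewrite HmuW in E. specialize (Wd k Hk).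
  assert (P := rfps_exp_nonneg mu k (fun j _ => Hmu0 j)).
  assert (D2 : 0 < divisor alpha (S k) ^ 2) by (apply pow_lt, divisor_pos; [exact Ha|lia]).
  assert (WS := Wp (S k)).
  assert (WS2 : 0 < W (S k) * divisor alpha (S k) ^ 2) by now apply Rmult_lt_0_compat.
  apply Rmult_le_reg_l with (W (S k) * divisor alpha (S k) ^ 2); [exact WS2|].
  assert (W k * rfps_exp mu k <= W (S k) * divisor alpha (S k) ^ 2 * rfps_exp mu k)
    by (apply Rmult_le_compat_r; assumption).
  assert (0 <= W (S k) * divisor alpha (S k) ^ 2 * mu (S k))
    by (apply Rmult_le_pos; [lra|apply Hmu0]).
  lra. }
set (x := exp (- (1))). assert (Hx : 0 < x) by apply exp_pos.
assert (Hex : x * exp 1 = 1) by (unfold x; rewrite <- exp_plus, Rplus_opp_l; apply exp_0).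
assert (Hmu_0 : mu O = 0) by (unfold mu; rewrite m_real_0 by exact Ha; unfold Rdiv; ring).
assert (Hsum : forall n, (n <= N)%nat -> sum_n (fun k => x ^ k * mu k) n <= 1).
{ intros n. induction n as [|n IH]; intros Hn.
  - rewrite sum_O, Hmu_0. lra.
  - specialize (IH ltac:(lia)).
    assert (E : sum_n (fun k => x ^ k * mu k) (S n)
      = x * sum_n (fun k => x ^ k * mu (S k)) n).
    { clear - Hmu_0. induction n as [|n IH].
      - rewrite sum_Sn, !sum_O, Hmu_0. unfold plus; simpl. ring.
      - rewrite sum_Sn, IH, sum_Sn. unfold plus; simpl. ring. }
    rewrite E, <- Hex. apply Rmult_le_compat_l; [lra|].
    apply Rle_trans with (sum_n (rfps_exp (fun k => x ^ k * mu k)) n).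
    + apply sum_n_le_loc. intros k Hk. rewrite rfps_exp_dilate.
      apply Rmult_le_compat_l; [apply pow_le; lra|apply Hrec; lia].
    + eapply Rle_trans; [apply rfps_exp_partial_sum|].
      * rewrite Hmu_0. ring.
      * intros k. apply Rmult_le_pos; [apply pow_le; lra|apply Hmu0].
      * destruct IH as [IH|IH]; [left; now apply exp_increasing|right; now rewrite IH]. }
assert (HN : x ^ N * mu N <= 1).
{ eapply Rle_trans; [|apply (Hsum N (le_n N))].
  destruct N as [|N']; [rewrite sum_O; lra|]. rewrite sum_Sn.
  assert (0 <= sum_n (fun k => x ^ k * mu k) N').
  { apply sum_n_nonneg. intros k _. apply Rmult_le_pos; [apply pow_le; lra|apply Hmu0]. }
  unfold plus; simpl. simpl in *. lra. }
rewrite Rpow_mult_distr, HmuW.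
assert (HxN : x ^ N * exp 1 ^ N = 1) by (rewrite <- Rpow_mult_distr, Hex; apply pow1).
apply Rmult_le_compat; [left; apply Wp|apply Hmu0|apply WD|].
assert (0 < x ^ N) by now apply pow_lt.
apply Rmult_le_reg_l with (x ^ N); [assumption|lra].
Qed.

(** * Convergence on the closed disk *)

Lemma is_series_le (a b : nat -> R) (l l' : R) :
  (forall k, a k <= b k) -> is_series a l -> is_series b l' -> l <= l'.
Proof.
intros H Ha Hb. apply (is_lim_seq_le (sum_n a) (sum_n b) l l').
- intros n. apply sum_n_le_loc. auto.
- exact Ha.
- exact Hb.
Qed.

(** The divisors [4 sin^2] are at most 4, so [m] dominates the solution of
    [4 y = x e^y]. *)
Lemma m_real_sum_inequality alpha x s : irrational alpha -> 0 <= x ->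
  is_series (fun k => x ^ k * m_real alpha k) s -> x * exp s <= 4 * s.
Proof.
intros Ha Hx H.
assert (H0 : x ^ 0 * m_real alpha 0 = 0) by (rewrite m_real_0 by exact Ha; ring).
assert (Hp : forall k, 0 <= x ^ k * m_real alpha k).
{ intros k. apply Rmult_le_pos; [now apply pow_le|now apply m_real_nonneg]. }
assert (HE := is_series_rfps_exp _ s H0 Hp H).
assert (H1 : is_series (fun k => x ^ S k * m_real alpha (S k)) s).
{ apply (is_series_incr_1 (fun k => x ^ k * m_real alpha k)). rewrite H0.
  change (is_series (fun k => x ^ k * m_real alpha k) (s + 0)). now rewrite Rplus_0_r. }
apply (is_series_le (fun k => x * rfps_exp (fun j => x ^ j * m_real alpha j) k)
  (fun k => 4 * (x ^ S k * m_real alpha (S k)))).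
- intros k. rewrite rfps_exp_dilate, <- m_real_S by exact Ha.
  assert (D1 := divisor_le_1 alpha (S k)).
  assert (D0 : 0 <= divisor alpha (S k)) by apply Rabs_pos.
  specialize (Hp (S k)). simpl pow in *.
  replace (x * (x ^ k * (4 * (divisor alpha (S k) * (divisor alpha (S k) * 1)) * m_real alpha (S k))))
    with (4 * (x * x ^ k * m_real alpha (S k)) * (divisor alpha (S k) * divisor alpha (S k))) by ring.
  rewrite <- (Rmult_1_r (4 * (x * x ^ k * m_real alpha (S k)))) at 2.
  apply Rmult_le_compat_l; nra.
- exact (is_series_scal (V := R_NormedModule) x _ _ HE).
- exact (is_series_scal (V := R_NormedModule) 4 _ _ H1).
Qed.

Lemma is_lim_seq_pow (u : nat -> R) (l : R) N :
  is_lim_seq u l -> is_lim_seq (fun j => u j ^ N) (l ^ N).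
Proof.
intros H. induction N as [|N IH]; simpl; [apply is_lim_seq_const|].
now apply is_lim_seq_mult'.
Qed.

(** For [0 < x < r] the sum [s] at [x] satisfies [x e^s <= 4 s].  With [s <= e^s]
    this gives [x <= 4], and with [s^2 / 4 <= e^s] it gives [x s <= 16]; the
    partial sums at [r] are limits of partial sums at [x >= r / 2], so they are
    bounded by [32 / r]. *)
Lemma radius_spec alpha : bounded_type alpha ->
  0 < radius alpha /\ ex_series (fun k => radius alpha ^ k * m_real alpha k).
Proof.
intros H. assert (Ha := proj1 H).
assert (Hmod : forall k, Cmod (m_coef alpha k) = m_real alpha k).
{ intros k. rewrite m_coef_real, Cmod_R, Rabs_pos_eq by auto using m_real_nonneg. reflexivity. }
set (a := fun k => Cmod (m_coef alpha k)).
assert (Hin : forall x, 0 <= x -> Rbar_lt x (CV_radius a) ->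
  exists s : R, is_series (fun k => x ^ k * m_real alpha k) s).
{ intros x Hx Hlt. destruct (CV_disk_inside a x) as [s Hs]; [now rewrite Rabs_pos_eq|].
  exists s. eapply is_series_R_ext; [|exact Hs]. intros k. cbv beta. unfold a.
  rewrite Hmod, Rabs_pos_eq; [apply Rmult_comm|].
  apply Rmult_le_pos; [now apply m_real_nonneg|now apply pow_le]. }
assert (Hpos : forall x s : R, 0 <= x -> is_series (fun k => x ^ k * m_real alpha k) s -> 0 <= s).
{ intros x s Hx Hs. eapply Rle_trans; [|apply (partial_sum_le _ _ 0 (fun k =>
    Rmult_le_pos _ _ (pow_le x k Hx) (m_real_nonneg alpha k Ha)) Hs)].
  rewrite sum_O, m_real_0 by exact Ha. lra. }
assert (Hup : forall x s : R, 0 < x -> is_series (fun k => x ^ k * m_real alpha k) s ->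
  x <= 4 /\ x * s <= 16).
{ intros x s Hx Hs. assert (I := m_real_sum_inequality alpha x s Ha ltac:(lra) Hs).
  assert (Hs0 := Hpos x s ltac:(lra) Hs).
  assert (E1 := exp_ineq1_le s). assert (E2 := exp_ineq1_le (s / 2)).
  assert (E3 : exp s = exp (s / 2) * exp (s / 2)) by (rewrite <- exp_plus; f_equal; field).
  split.
  - apply Rmult_le_reg_r with (exp s); [apply exp_pos|]. lra.
  - destruct Hs0 as [Hs0|Hs0]; [|nra].
    assert (s * s / 4 <= exp s) by nra.
    assert (x * (s * s / 4) <= 4 * s) by (apply Rle_trans with (2 := I); apply Rmult_le_compat_l; lra).
    apply Rmult_le_reg_r with s; nra. }
destruct (m_real_geometric_bound alpha H) as [D [HD HmD]].
assert (Hlub := CV_radius_bounded a).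
assert (Hlow : Rbar_le (/ D) (CV_radius a)).
{ apply Hlub. exists 1. intros k. unfold a. rewrite Hmod.
  assert (0 < D ^ k) by now apply pow_lt.
  rewrite pow_inv, Rabs_pos_eq.
  - apply Rmult_le_reg_r with (D ^ k); [assumption|].
    rewrite Rmult_assoc, Rinv_l by lra. specialize (HmD k). lra.
  - apply Rmult_le_pos; [now apply m_real_nonneg|]. left. now apply Rinv_0_lt_compat. }
assert (HiD : 0 < / D) by now apply Rinv_0_lt_compat.
unfold radius. fold a.
destruct (CV_radius a) as [r| |] eqn:Er; simpl in Hlow; [|exfalso|contradiction].
2:{ destruct (Hin 5 ltac:(lra) I) as [s Hs]. destruct (Hup 5 s ltac:(lra) Hs). lra. }
simpl real. assert (Hr : 0 < r) by lra. split; [exact Hr|].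
apply (ex_series_bounded _ (32 / r)).
{ intros k. apply Rmult_le_pos; [apply pow_le; lra|now apply m_real_nonneg]. }
intros n.
assert (Hpart : forall x, r / 2 <= x < r ->
  sum_n (fun k => x ^ k * m_real alpha k) n <= 32 / r).
{ intros x Hx. destruct (Hin x ltac:(lra)) as [s Hs]; [apply Hx|].
  apply Rle_trans with s.
  - apply partial_sum_le; [|exact Hs].
    intros k. apply Rmult_le_pos; [apply pow_le; lra|now apply m_real_nonneg].
  - destruct (Hup x s ltac:(lra) Hs) as [_ B]. assert (Hs0 := Hpos x s ltac:(lra) Hs).
    apply Rle_div_r; [lra|]. nra. }
set (u := fun j => r - r * (1/2) ^ (S j)).
assert (Hu : is_lim_seq u r).
{ unfold u. replace (Finite r) with (Finite (r - r * 0)) by (f_equal; ring).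
  apply is_lim_seq_minus'; [apply is_lim_seq_const|].
  apply (is_lim_seq_scal_l _ r 0).
  apply (is_lim_seq_incr_1 (fun j => (1/2) ^ j)). apply is_lim_seq_geom.
  rewrite Rabs_pos_eq; lra. }
assert (Hlim : is_lim_seq (fun j => sum_n (fun k => u j ^ k * m_real alpha k) n)
  (sum_n (fun k => r ^ k * m_real alpha k) n)).
{ clear - Hu. induction n as [|n IH].
  - rewrite sum_O. apply (is_lim_seq_ext (fun j => u j ^ 0 * m_real alpha 0)).
    { intros j. now rewrite sum_O. }
    apply is_lim_seq_mult'; [now apply is_lim_seq_pow|apply is_lim_seq_const].
  - rewrite sum_Sn. apply (is_lim_seq_ext (fun j => sum_n (fun k => u j ^ k * m_real alpha k) n
      + u j ^ S n * m_real alpha (S n))).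
    { intros j. now rewrite sum_Sn. }
    apply is_lim_seq_plus'; [exact IH|].
    apply is_lim_seq_mult'; [now apply is_lim_seq_pow|apply is_lim_seq_const]. }
apply (is_lim_seq_le _ _ _ (32 / r)) with (2 := Hlim) (3 := is_lim_seq_const _).
intros j. apply Hpart. unfold u.
assert (P1 : 0 < (1/2) ^ j) by (apply pow_lt; lra).
assert (P2 : (1/2) ^ j <= 1 ^ j) by (apply pow_incr; lra). rewrite pow1 in P2.
simpl pow. nra.
Qed.

Lemma ex_series_m_disk alpha x : bounded_type alpha -> Cmod x <= radius alpha ->
  ex_series (fun k => Cmod (x ^ k * m_coef alpha k)).
Proof.
intros H Hx. assert (Ha := proj1 H). destruct (radius_spec alpha H) as [Hr He].
apply (ex_series_le (V := R_CompleteNormedModule)) with (2 := He).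
intros k. unfold norm; simpl; unfold abs; simpl. rewrite Rabs_pos_eq by apply Cmod_ge_0.
rewrite Cmod_mult, Cmod_pow, m_coef_real, Cmod_R, Rabs_pos_eq by auto using m_real_nonneg.
apply Rmult_le_compat_r; [now apply m_real_nonneg|].
apply pow_incr. split; [apply Cmod_ge_0|exact Hx].
Qed.

Lemma pow_n_C (x : C) k : @pow_n C_Ring x k = (x ^ k)%C.
Proof. induction k as [|k IH]; [reflexivity|]. rewrite Cpow_S, <- IH. reflexivity. Qed.

Lemma m_fun_series alpha x : bounded_type alpha -> Cmod x <= radius alpha ->
  Cseries (fun k => x ^ k * m_coef alpha k)%C (m_fun alpha x).
Proof.
intros H Hx. destruct (ex_Cseries _ (ex_series_m_disk alpha x H Hx)) as [l Hl].
replace (m_fun alpha x) with l; [exact Hl|].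
assert (Hs : @is_pseries C_AbsRing C_NormedModule (m_coef alpha) x l).
{ apply Cseries_is_series. eapply Cseries_ext; [|exact Hl]. intros k. cbv beta.
  rewrite <- pow_n_C. reflexivity. }
symmetry. apply (@iota_unique _ C_CompleteNormedModule); [|exact Hs].
intros y Hy. exact (filterlim_locally_unique _ _ _ Hy Hs).
Qed.

Lemma Cmod_lambda alpha : Cmod (lambda alpha) = 1.
Proof. apply Cmod_Cexp_imag. Qed.

Lemma functional_equation alpha x : bounded_type alpha -> Cmod x <= radius alpha ->
  (m_fun alpha (lambda alpha * x) - 2 * m_fun alpha x + m_fun alpha (/ lambda alpha * x)
   = - Z_fun alpha x)%C.
Proof.
intros H Hx. assert (Ha := proj1 H).
assert (Hl : lambda alpha <> RtoC 0) by apply Cexp_neq_0.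
assert (S0 := m_fun_series alpha x H Hx).
assert (S1 := m_fun_series alpha (lambda alpha * x) H
  ltac:(rewrite Cmod_mult, Cmod_lambda; lra)).
assert (S2 := m_fun_series alpha (/ lambda alpha * x) H
  ltac:(rewrite Cmod_mult, Cmod_inv, Cmod_lambda by exact Hl; lra)).
assert (L := Cseries_plus _ _ _ _ (Cseries_plus _ _ _ _ S1 (Cseries_mult_l (- (2)) _ _ S0)) S2).
apply Cseries_incr_1 in L.
2:{ rewrite (proj1 (m_coef_solution alpha Ha)). ring. }
assert (RHS := Cseries_mult_l (- x) _ _ (Cseries_fps_exp (fps_dilate x (m_coef alpha)) _
  ltac:(unfold fps_dilate; rewrite (proj1 (m_coef_solution alpha Ha)); ring)
  (ex_series_m_disk alpha x H Hx) S0)).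
transitivity (- x * Cexp (m_fun alpha x))%C; [|unfold Z_fun; ring].
transitivity (m_fun alpha (lambda alpha * x) + - (2) * m_fun alpha x
  + m_fun alpha (/ lambda alpha * x))%C; [ring|].
apply (Cseries_unique _ _ _ L). eapply Cseries_ext; [|exact RHS].
intros k. cbv beta. rewrite fps_exp_dilate. unfold fps_dilate.
assert (E := proj2 (m_coef_solution alpha Ha) (S k)). unfold fps_dilate in E.
rewrite !Cpow_mult_l.
transitivity (x ^ S k * (lambda alpha ^ S k * m_coef alpha (S k) - 2 * m_coef alpha (S k)
  + (/ lambda alpha) ^ S k * m_coef alpha (S k)))%C; [|ring].
rewrite E. simpl fps_mulX. rewrite Cpow_S. ring.
Qed.

(** * The dynamics on the boundary curve *)

Definition boundary_point (alpha t : R) : C := (RtoC (radius alpha) * Cexp (Ci * RtoC t))%C.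

Lemma Cmod_boundary_point alpha t : bounded_type alpha ->
  Cmod (boundary_point alpha t) = radius alpha.
Proof.
intros H. unfold boundary_point. rewrite Cmod_mult, Cmod_Cexp_imag, Cmod_R, Rabs_pos_eq.
- ring.
- left. now apply radius_spec.
Qed.

Lemma boundary_point_rotation alpha t :
  (lambda alpha * boundary_point alpha t)%C = boundary_point alpha (t + 2 * PI * alpha).
Proof.
unfold boundary_point, lambda.
transitivity (RtoC (radius alpha) *
  (Cexp (Ci * RtoC t) * Cexp (Ci * RtoC (2 * PI * alpha))))%C; [ring|].
rewrite <- Cexp_add. do 2 f_equal. rewrite RtoC_plus. ring.
Qed.

Lemma Gamma_eq alpha t :
  Gamma alpha t = (Z_fun alpha (boundary_point alpha t),
    (m_fun alpha (boundary_point alpha (t + 2 * PI * alpha))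
     - m_fun alpha (boundary_point alpha t))%C).
Proof.
unfold Gamma, Gamma_disk. fold (boundary_point alpha t).
now rewrite boundary_point_rotation.
Qed.

(** The first component is the definition of [Z]; the second is the functional
    equation at [lambda x]. *)
Lemma Gamma_conjugacy alpha t : bounded_type alpha ->
  dynamics alpha (Gamma alpha t) = Gamma alpha (t + 2 * PI * alpha).
Proof.
intros H. rewrite !Gamma_eq. unfold dynamics, fst, snd.
set (x := boundary_point alpha t).
assert (E : (lambda alpha * Z_fun alpha x * Cexp
   (m_fun alpha (boundary_point alpha (t + 2 * PI * alpha)) - m_fun alpha x))%C
  = Z_fun alpha (boundary_point alpha (t + 2 * PI * alpha))).
{ unfold Z_fun. rewrite <- boundary_point_rotation. fold x.
  transitivity (lambda alpha * x * (Cexp (m_fun alpha x)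
    * Cexp (m_fun alpha (lambda alpha * x) - m_fun alpha x)))%C; [ring|].
  rewrite <- Cexp_add. do 2 f_equal. ring. }
rewrite E. f_equal.
assert (F := functional_equation alpha (boundary_point alpha (t + 2 * PI * alpha)) H
  ltac:(rewrite Cmod_boundary_point by exact H; lra)).
rewrite (boundary_point_rotation alpha (t + 2 * PI * alpha)) in F.
rewrite <- (boundary_point_rotation alpha t), Cmult_assoc, Cinv_l, Cmult_1_l in F
  by apply Cexp_neq_0.
rewrite boundary_point_rotation in F. fold x in F.
replace (Z_fun alpha (boundary_point alpha (t + 2 * PI * alpha)))
  with (- - Z_fun alpha (boundary_point alpha (t + 2 * PI * alpha)))%C by ring.
rewrite <- F. ring.
Qed.

Lemma Gamma_conjugacy_iter alpha s t n : bounded_type alpha ->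
  Gamma alpha s = Gamma alpha t ->
  Gamma alpha (s + INR n * (2 * PI * alpha)) = Gamma alpha (t + INR n * (2 * PI * alpha)).
Proof.
intros H E. induction n as [|n IH].
- simpl. now rewrite !Rmult_0_l, !Rplus_0_r.
- rewrite S_INR.
  replace (s + (INR n + 1) * (2 * PI * alpha)) with (s + INR n * (2 * PI * alpha) + 2 * PI * alpha) by ring.
  replace (t + (INR n + 1) * (2 * PI * alpha)) with (t + INR n * (2 * PI * alpha) + 2 * PI * alpha) by ring.
  now rewrite <- !Gamma_conjugacy, IH.
Qed.

Lemma same_angle_Cexp s t : same_angle s t <-> Cexp (Ci * RtoC s) = Cexp (Ci * RtoC t).
Proof.
rewrite !Cexp_imag. split.
- intros [k ->].
  assert (S : sin (2 * PI * IZR k / 2) = 0) by (apply sin_eq_0_1; exists k; field).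
  assert (Cc : cos (2 * PI * IZR k) = 1).
  { replace (2 * PI * IZR k) with (2 * (2 * PI * IZR k / 2)) by field.
    rewrite cos_2a_sin, S. ring. }
  assert (Ss : sin (2 * PI * IZR k) = 0).
  { replace (2 * PI * IZR k) with (2 * (2 * PI * IZR k / 2)) by field.
    rewrite sin_2a, S. ring. }
  rewrite cos_plus, sin_plus, Cc, Ss. f_equal; ring.
- intros E. injection E as Ec Es.
  assert (D : cos (s - t) = 1).
  { rewrite cos_minus, Ec, Es. assert (H := sin2_cos2 t). unfold Rsqr in H. lra. }
  replace (s - t) with (2 * ((s - t) / 2)) in D by field.
  rewrite cos_2a_sin in D.
  assert (Z0 : sin ((s - t) / 2) = 0) by nra.
  apply sin_eq_0_0 in Z0. destruct Z0 as [k Hk]. exists k. lra.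
Qed.

Lemma Gamma_circle_map alpha : circle_map (Gamma alpha).
Proof.
intros s t E. apply same_angle_Cexp in E. unfold Gamma. now rewrite E.
Qed.

(** * Injectivity *)

Lemma geometric_sum (w : C) N : ((w - 1) * sum_n (fun j => w ^ j) N = w ^ S N - 1)%C.
Proof.
induction N as [|N IH].
- rewrite sum_O. simpl. ring.
- rewrite sum_Sn. change (plus ?a ?b) with (a + b)%C.
  rewrite Cmult_plus_distr_l, IH, !Cpow_S. ring.
Qed.

(** Birkhoff average of the powers of [w]. *)
Definition mean_power (w : C) (N : nat) : C := (RtoC (/ INR (S N)) * sum_n (fun j => w ^ j) N)%C.

Lemma Cmod_mean_power_le_1 w N : Cmod w = 1 -> Cmod (mean_power w N) <= 1.
Proof.
intros H. unfold mean_power. rewrite Cmod_mult, Cmod_R.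
assert (P : 0 < INR (S N)) by (apply lt_0_INR; lia).
rewrite Rabs_pos_eq by (left; now apply Rinv_0_lt_compat).
apply Rmult_le_reg_l with (INR (S N)); [exact P|].
rewrite <- Rmult_assoc, Rinv_r, Rmult_1_l, Rmult_1_r by lra.
eapply Rle_trans; [apply Cmod_sum_n|].
rewrite (sum_n_ext _ (fun _ => 1)); [rewrite sum_n_const; lra|].
intros j. now rewrite Cmod_pow, H, pow1.
Qed.

Lemma Cmod_mean_power_lim w : Cmod w = 1 -> w <> RtoC 1 ->
  is_lim_seq (fun N => Cmod (mean_power w N)) 0.
Proof.
intros H H1. assert (Hw : (w - 1)%C <> RtoC 0).
{ intros E. apply H1. replace w with ((w - 1) + 1)%C by ring. rewrite E. ring. }
assert (P := proj1 (Cmod_gt_0 _) Hw).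
apply (is_lim_seq_le_le (fun _ => 0) _ (fun N => 2 / Cmod (w - 1) * / INR (S N))).
- intros N. split; [apply Cmod_ge_0|].
  assert (PN : 0 < / INR (S N)) by (apply Rinv_0_lt_compat, lt_0_INR; lia).
  unfold mean_power. rewrite Cmod_mult, Cmod_R, Rabs_pos_eq, Rmult_comm by lra.
  apply Rmult_le_compat_r; [lra|]. apply Rle_div_r; [exact P|].
  rewrite Rmult_comm, <- Cmod_mult, geometric_sum. unfold Cminus.
  eapply Rle_trans; [apply Cmod_triangle|].
  rewrite Cmod_opp, Cmod_1, Cmod_pow, H, pow1. lra.
- apply is_lim_seq_const.
- replace (Finite 0) with (Finite (2 / Cmod (w - 1) * 0)) by (f_equal; ring).
  apply (is_lim_seq_scal_l _ _ 0).
  apply (is_lim_seq_incr_1 (fun N => / INR N)).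
  apply (is_lim_seq_inv _ p_infty is_lim_seq_INR). discriminate.
Qed.

(** Averaging [lambda^(-j) sum_k d_k lambda^(j k)] over [j] kills every term but
    [k = 1], because no other [lambda^(k - 1)] equals 1. *)
Lemma orbit_determines_linear_coefficient alpha (d : nat -> C) : irrational alpha ->
  ex_series (fun k => Cmod (d k)) ->
  (forall j, Cseries (fun k => (lambda alpha ^ j) ^ k * d k)%C (RtoC 0)) ->
  d 1%nat = RtoC 0.
Proof.
intros Ha Hd H.
assert (Hl : lambda alpha <> RtoC 0) by apply Cexp_neq_0.
set (w := fun k => (lambda alpha ^ k / lambda alpha)%C).
assert (Hw : forall k, Cmod (w k) = 1).
{ intros k. unfold w. rewrite Cmod_div, Cmod_pow, Cmod_lambda, pow1 by exact Hl. field. }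
assert (Hw1 : forall k, k <> 1%nat -> w k <> RtoC 1).
{ intros k Hk E.
  assert (E' : (lambda alpha ^ k = lambda alpha)%C).
  { transitivity (w k * lambda alpha)%C; [unfold w; field; exact Hl|]. rewrite E. ring. }
  destruct k as [|k].
  - apply (lambda_pow_neq_1 alpha 1 Ha); [lia|]. rewrite Cpow_1_r. now rewrite <- E'.
  - apply (lambda_pow_neq_1 alpha k Ha); [lia|]. rewrite Cpow_S in E'.
    transitivity (/ lambda alpha * (lambda alpha * lambda alpha ^ k))%C; [field; exact Hl|].
    rewrite E'. field. exact Hl. }
assert (Hmean : forall N, Cseries (fun k => mean_power (w k) N * d k)%C (RtoC 0)).
{ intros N. unfold mean_power.
  apply (Cseries_ext (fun k => RtoC (/ INR (S N)) * (sum_n (fun j => w k ^ j) N * d k))%C).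
  { intros k. ring. }
  replace (RtoC 0) with (RtoC (/ INR (S N)) * 0)%C by ring. apply Cseries_mult_l.
  assert (T : forall j, Cseries (fun k => w k ^ j * d k)%C (RtoC 0)).
  { intros j. replace (RtoC 0) with ((/ lambda alpha) ^ j * 0)%C by ring.
    eapply Cseries_ext; [|apply Cseries_mult_l, (H j)].
    intros k. cbv beta. unfold w, Cdiv. rewrite Cpow_mult_l, <- !Cpow_mult_r, (Nat.mul_comm j k). ring. }
  induction N as [|N IH].
  - apply (Cseries_ext (fun k => w k ^ 0 * d k)%C); [|apply T].
    intros k. now rewrite sum_O.
  - apply (Cseries_ext (fun k => sum_n (fun j => w k ^ j) N * d k + w k ^ S N * d k)%C).
    + intros k. rewrite sum_Sn. symmetry. apply Cmult_plus_distr_r.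
    + replace (RtoC 0) with (0 + 0)%C by ring. apply Cseries_plus; [exact IH|apply T]. }
assert (Hone : forall N, mean_power (w 1%nat) N = RtoC 1).
{ intros N. unfold mean_power. replace (w 1%nat) with (RtoC 1).
  2:{ unfold w. rewrite Cpow_1_r. field. exact Hl. }
  rewrite (sum_n_C_ext _ (fun _ => RtoC 1)) by (intros; apply Cpow_1_l).
  rewrite sum_n_RtoC, sum_n_const, <- RtoC_mult. f_equal. field. apply not_0_INR. lia. }
assert (Hcomp : forall h : C -> R, h (RtoC 0) = 0 ->
  (forall z, Rabs (h z) <= Cmod z) ->
  (forall b l, Cseries b l -> is_series (fun k => h (b k)) (h l)) ->
  h (d 1%nat) = 0).
{ intros h h0 Hh Hser.
  assert (L : is_lim_seq (fun _ => h (RtoC 0)) (h (d 1%nat))).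
  { apply (tannery (fun N k => h (mean_power (w k) N * d k)%C) _
      (fun k => if Nat.leb k 1 then (if Nat.eqb k 1 then h (d 1%nat) else 0) else 0)
      (fun k => Cmod (d k))).
    - intros N. apply (Hser (fun k => mean_power (w k) N * d k)%C), Hmean.
    - intros N k. eapply Rle_trans; [apply Hh|]. rewrite Cmod_mult.
      rewrite <- (Rmult_1_l (Cmod (d k))) at 2.
      apply Rmult_le_compat_r; [apply Cmod_ge_0|now apply Cmod_mean_power_le_1].
    - exact Hd.
    - intros k. destruct (Nat.eq_dec k 1) as [->|Hk].
      + simpl. apply (is_lim_seq_ext (fun _ => h (d 1%nat))); [|apply is_lim_seq_const].
        intros N. now rewrite Hone, Cmult_1_l.
      + replace (if Nat.leb k 1 then (if Nat.eqb k 1 then h (d 1%nat) else 0) else 0) with 0.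
        2:{ apply Nat.eqb_neq in Hk. rewrite Hk. now destruct (Nat.leb k 1). }
        apply is_lim_seq_abs_0.
        apply (is_lim_seq_le_le (fun _ => 0) _ (fun N => Cmod (mean_power (w k) N) * Cmod (d k))).
        * intros N. split; [apply Rabs_pos|]. rewrite <- Cmod_mult. apply Hh.
        * apply is_lim_seq_const.
        * replace (Finite 0) with (Finite (0 * Cmod (d k))) by (f_equal; ring).
          apply is_lim_seq_mult'; [|apply is_lim_seq_const].
          apply Cmod_mean_power_lim; auto.
    - assert (Q := is_series_trunc (fun k => if Nat.eqb k 1 then h (d 1%nat) else 0) 1).
      rewrite sum_Sn, sum_O in Q. change (plus _ _) with (0 + h (d 1%nat)) in Q.
      now rewrite Rplus_0_l in Q. }
  rewrite h0 in L. apply is_lim_seq_unique in L. rewrite Lim_seq_const in L.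
  injection L as L. now symmetry. }
assert (Hf : fst (d 1%nat) = 0).
{ apply Hcomp; [reflexivity|apply Rabs_fst_le|]. intros b l [B1 B2]. exact B1. }
assert (Hs : snd (d 1%nat) = 0).
{ apply Hcomp; [reflexivity|apply Rabs_snd_le|]. intros b l [B1 B2]. exact B2. }
destruct (d 1%nat) as [u v]. simpl in Hf, Hs. now subst.
Qed.

Lemma boundary_point_iter alpha t n :
  boundary_point alpha (t + INR n * (2 * PI * alpha)) = (lambda alpha ^ n * boundary_point alpha t)%C.
Proof.
induction n as [|n IH].
- simpl. rewrite Rmult_0_l, Rplus_0_r. ring.
- rewrite S_INR.
  replace (t + (INR n + 1) * (2 * PI * alpha)) with (t + INR n * (2 * PI * alpha) + 2 * PI * alpha) by ring.
  rewrite <- boundary_point_rotation, IH, Cpow_S. ring.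
Qed.

Lemma u_series alpha t n : bounded_type alpha ->
  Cseries (fun k => (lambda alpha ^ n) ^ k * ((lambda alpha ^ k - 1) * m_coef alpha k
      * boundary_point alpha t ^ k))%C
    (snd (Gamma alpha (t + INR n * (2 * PI * alpha))) : C).
Proof.
intros H. rewrite Gamma_eq. unfold snd.
assert (D : forall s, Cmod (boundary_point alpha s) <= radius alpha)
  by (intros s; rewrite Cmod_boundary_point by exact H; lra).
assert (S1 := m_fun_series alpha _ H (D (t + INR n * (2 * PI * alpha) + 2 * PI * alpha))).
assert (S2 := m_fun_series alpha _ H (D (t + INR n * (2 * PI * alpha)))).
set (u := m_fun alpha (boundary_point alpha (t + INR n * (2 * PI * alpha) + 2 * PI * alpha))) in *.
set (v := m_fun alpha (boundary_point alpha (t + INR n * (2 * PI * alpha)))) in *.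
replace (u - v)%C with (u + - (1) * v)%C by ring.
eapply Cseries_ext; [|apply (Cseries_plus _ _ _ _ S1 (Cseries_mult_l (- (1)) _ _ S2))].
intros k. cbv beta. rewrite <- boundary_point_rotation, boundary_point_iter, !Cpow_mult_l. ring.
Qed.

(** The orbits of [x] and [y] carry the same values of [u], so the series with
    coefficients [(lambda^k - 1) m_k (x^k - y^k)] vanishes along the rotation and
    its linear coefficient [(lambda - 1) m_1 (x - y)] is zero. *)
Lemma Gamma_injective alpha : bounded_type alpha -> circle_injective (Gamma alpha).
Proof.
intros H s t E. assert (Ha := proj1 H).
set (x := boundary_point alpha s). set (y := boundary_point alpha t).
assert (Hl : forall k, Cmod (lambda alpha ^ k - 1) <= 2).
{ intros k. unfold Cminus. eapply Rle_trans; [apply Cmod_triangle|].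
  rewrite Cmod_opp, Cmod_1, Cmod_pow, Cmod_lambda, pow1. lra. }
assert (Hx : Cmod x = radius alpha) by now apply Cmod_boundary_point.
assert (Hy : Cmod y = radius alpha) by now apply Cmod_boundary_point.
assert (D := orbit_determines_linear_coefficient alpha
  (fun k => (lambda alpha ^ k - 1) * m_coef alpha k * (x ^ k - y ^ k))%C Ha).
assert (D1 : ((lambda alpha ^ 1 - 1) * m_coef alpha 1%nat * (x ^ 1 - y ^ 1))%C = RtoC 0).
{ apply D.
  - destruct (radius_spec alpha H) as [Hr [S HS]].
    apply (ex_series_le (V := R_CompleteNormedModule)) with
      (fun k => 4 * (radius alpha ^ k * m_real alpha k)).
    2:{ eexists. apply (is_series_scal (V := R_NormedModule)), HS. }
    intros k. unfold norm; simpl; unfold abs; simpl. rewrite Rabs_pos_eq by apply Cmod_ge_0.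
    rewrite !Cmod_mult, m_coef_real, Cmod_R, Rabs_pos_eq by auto using m_real_nonneg.
    assert (B : Cmod (x ^ k - y ^ k) <= 2 * radius alpha ^ k).
    { unfold Cminus. eapply Rle_trans; [apply Cmod_triangle|].
      rewrite Cmod_opp, !Cmod_pow, Hx, Hy. lra. }
    assert (M := m_real_nonneg alpha k Ha).
    replace (4 * (radius alpha ^ k * m_real alpha k))
      with (2 * m_real alpha k * (2 * radius alpha ^ k)) by ring.
    apply Rmult_le_compat; [|apply Cmod_ge_0| |exact B].
    + apply Rmult_le_pos; [apply Cmod_ge_0|exact M].
    + apply Rmult_le_compat_r; [exact M|apply Hl].
  - intros j. assert (Ex := u_series alpha s j H). assert (Ey := u_series alpha t j H).
    rewrite (Gamma_conjugacy_iter alpha s t j H E) in Ex. fold x in Ex. fold y in Ey.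
    set (u := snd (Gamma alpha (t + INR j * (2 * PI * alpha))) : C) in *.
    replace (RtoC 0) with (u + - (1) * u)%C by ring.
    eapply Cseries_ext; [|apply (Cseries_plus _ _ _ _ Ex (Cseries_mult_l (- (1)) _ _ Ey))].
    intros k. cbv beta. ring. }
rewrite !Cpow_1_r in D1.
assert (N1 : (lambda alpha - 1)%C <> RtoC 0).
{ intros F. apply (lambda_pow_neq_1 alpha 1 Ha); [lia|]. rewrite Cpow_1_r.
  replace (lambda alpha) with ((lambda alpha - 1) + 1)%C by ring. rewrite F. ring. }
assert (N2 : m_coef alpha 1%nat <> RtoC 0).
{ rewrite m_coef_real by exact Ha. intros F. apply RtoC_inj in F.
  assert (P := m_real_1_pos alpha Ha). lra. }
assert (Exy : (x - y)%C = RtoC 0).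
{ destruct (Classical_Prop.classic ((x - y)%C = RtoC 0)) as [F|F]; [exact F|].
  exfalso. apply (Cmult_neq_0 _ _ (Cmult_neq_0 _ _ N1 N2) F D1). }
apply same_angle_Cexp.
assert (Hr : RtoC (radius alpha) <> RtoC 0).
{ intros F. apply RtoC_inj in F. destruct (radius_spec alpha H). lra. }
unfold x, y, boundary_point in Exy.
transitivity (Cexp (Ci * RtoC t) + / RtoC (radius alpha) *
  (RtoC (radius alpha) * Cexp (Ci * RtoC s) - RtoC (radius alpha) * Cexp (Ci * RtoC t)))%C.
- field. exact Hr.
- rewrite Exy. ring.
Qed.

(** * Immersion *)

Lemma is_derive_linear {V W : NormedModule R_AbsRing} (L : V -> W) (f : R -> V) (t : R) (l : V) :
  is_linear L -> is_derive f t l -> is_derive (fun s => L (f s)) t (L l).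
Proof.
intros HL Hf. unfold is_derive.
eapply filterdiff_ext_lin.
- apply (filterdiff_comp' f L t _ L Hf). now apply filterdiff_linear.
- intros y. simpl. now apply linear_scal.
Qed.

Definition coordinate (i j : bool) (p : C2) : R :=
  let z : C := if i then fst p else snd p in if j then fst z else snd z.

Lemma is_linear_coordinate i j : @is_linear R_AbsRing C2 R_NormedModule (coordinate i j).
Proof.
assert (H1 : @is_linear R_AbsRing C2 C_R_NormedModule fst) by apply is_linear_fst.
assert (H2 : @is_linear R_AbsRing C2 C_R_NormedModule snd) by apply is_linear_snd.
assert (H3 : @is_linear R_AbsRing C_R_NormedModule R_NormedModule fst)
  by exact (@is_linear_fst R_AbsRing R_NormedModule R_NormedModule).
assert (H4 : @is_linear R_AbsRing C_R_NormedModule R_NormedModule snd)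
  by exact (@is_linear_snd R_AbsRing R_NormedModule R_NormedModule).
destruct i, j.
- exact (is_linear_comp _ _ H1 H3).
- exact (is_linear_comp _ _ H1 H4).
- exact (is_linear_comp _ _ H2 H3).
- exact (is_linear_comp _ _ H2 H4).
Qed.

Lemma coordinate_ext (p q : C2) : (forall i j, coordinate i j p = coordinate i j q) -> p = q.
Proof.
intros H. destruct p as [[a b] [c d]], q as [[a' b'] [c' d']].
assert (H1 := H true true). assert (H2 := H true false).
assert (H3 := H false true). assert (H4 := H false false).
unfold coordinate in *. simpl in *. now subst.
Qed.

Lemma coordinate_zero i j : coordinate i j zero = 0.
Proof. now destruct i, j. Qed.

Lemma is_derive_C2_unique (f : R -> C2) t l l' : is_derive f t l -> is_derive f t l' -> l = l'.
Proof.
intros H H'. apply coordinate_ext. intros i j.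
assert (D := is_derive_linear _ f t l (is_linear_coordinate i j) H).
assert (D' := is_derive_linear _ f t l' (is_linear_coordinate i j) H').
apply is_derive_unique in D, D'. congruence.
Qed.

Lemma is_derive_shift (f : R -> C2) t c l :
  is_derive f (t + c) l -> is_derive (fun s => f (s + c)) t l.
Proof.
intros H.
assert (E : is_derive (fun s : R => s + c) t 1) by (auto_derive; [exact I|ring]).
assert (D := is_derive_comp f (fun s => s + c) t l 1 H E).
change (scal 1 l) with (scal (one : R_AbsRing) l) in D. now rewrite scal_one in D.
Qed.

(** The differential of a smooth map sends the zero vector to the zero vector. *)
Lemma dynamics_critical_point alpha (f : R -> C2) t l :
  is_derive f t zero -> is_derive (fun s => dynamics alpha (f s)) t l -> l = zero.
Proof.
intros Hf Hl. apply coordinate_ext. intros i j.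
assert (Dl := is_derive_linear _ _ t l (is_linear_coordinate i j) Hl).
assert (D : forall i j, is_derive (fun s => coordinate i j (f s)) t 0).
{ intros i' j'. rewrite <- (coordinate_zero i' j'). exact (is_derive_linear _ f t _ (is_linear_coordinate i' j') Hf). }
assert (D11 := D true true). assert (D12 := D true false).
assert (D21 := D false true). assert (D22 := D false false). clear D.
set (a := fun s => coordinate true true (f s)) in *.
set (b := fun s => coordinate true false (f s)) in *.
set (c := fun s => coordinate false true (f s)) in *.
set (d := fun s => coordinate false false (f s)) in *.
assert (E : forall s, dynamics alpha (f s) =
  dynamics alpha ((a s, b s), (c s, d s))).
{ intros s. unfold a, b, c, d, coordinate. destruct (f s) as [[? ?] [? ?]]. reflexivity. }
destruct (lambda alpha) as [p q] eqn:El.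
assert (Dz : is_derive (fun s => coordinate i j (dynamics alpha (f s))) t 0).
{ apply (is_derive_ext (fun s => coordinate i j (dynamics alpha ((a s, b s), (c s, d s))))).
  { intros s. now rewrite E. }
  assert (Xa : ex_derive a t) by (eexists; exact D11).
  assert (Xb : ex_derive b t) by (eexists; exact D12).
  assert (Xc : ex_derive c t) by (eexists; exact D21).
  assert (Xd : ex_derive d t) by (eexists; exact D22).
  change (is_derive a t 0) in D11. change (is_derive b t 0) in D12.
  change (is_derive c t 0) in D21. change (is_derive d t 0) in D22.
  clearbody a b c d. clear - El D11 D12 D21 D22 Xa Xb Xc Xd.
  assert (Da : Derive (fun x : R => a x) t = 0) by exact (is_derive_unique _ _ _ D11).
  assert (Db : Derive (fun x : R => b x) t = 0) by exact (is_derive_unique _ _ _ D12).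
  assert (Dc : Derive (fun x : R => c x) t = 0) by exact (is_derive_unique _ _ _ D21).
  assert (Dd : Derive (fun x : R => d x) t = 0) by exact (is_derive_unique _ _ _ D22).
  unfold dynamics, coordinate. rewrite El. unfold Cexp, Cmult, Cminus, Cplus, Copp.
  destruct i, j; simpl; auto_derive; try tauto;
    rewrite ?Da, ?Db, ?Dc, ?Dd; ring. }
rewrite coordinate_zero.
apply is_derive_unique in Dl, Dz. rewrite <- Dz. symmetry. exact Dl.
Qed.

(** The critical parameters are invariant under the rotation, hence dense,
    hence everything as the derivative is continuous: the curve would be
    constant. *)
Lemma Gamma_immersion alpha : bounded_type alpha -> class_C1 (Gamma alpha) ->
  immersion (Gamma alpha).
Proof.
intros H HC. split; [exact HC|]. intros t0 l Hl El. rewrite El in Hl. clear l El.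
destruct HC as [f' [Hf' Hc]].
assert (Ha := proj1 H).
assert (Horb : forall n, f' (t0 + INR n * (2 * PI * alpha)) = zero).
{ intros n. induction n as [|n IH].
  - replace (t0 + INR 0 * (2 * PI * alpha)) with t0 by (simpl; ring).
    apply (is_derive_C2_unique (Gamma alpha) t0); [apply Hf'|exact Hl].
  - set (t := t0 + INR n * (2 * PI * alpha)) in *.
    replace (t0 + INR (S n) * (2 * PI * alpha)) with (t + 2 * PI * alpha)
      by (unfold t; rewrite S_INR; ring).
    apply (dynamics_critical_point alpha (Gamma alpha) t).
    + rewrite <- IH. apply Hf'.
    + apply (is_derive_ext (fun s => Gamma alpha (s + 2 * PI * alpha))).
      * intros s. symmetry. now apply Gamma_conjugacy.
      * apply is_derive_shift, Hf'. }
assert (Hper : forall t k, f' (t + 2 * PI * IZR k) = f' t).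
{ intros t k. apply (is_derive_C2_unique (Gamma alpha) t); [|apply Hf'].
  apply (is_derive_ext (fun s => Gamma alpha (s + 2 * PI * IZR k))).
  - intros s. apply Gamma_circle_map. exists k. reflexivity.
  - apply is_derive_shift, Hf'. }
assert (Hz : forall t, f' t = zero).
{ intros t. apply eq_close. intros eps.
  destruct (proj1 (filterlim_locally _ _) (Hc t) eps) as [del Hdel].
  assert (P2 : 0 < 2 * PI) by (assert (P := PI_RGT_0); lra).
  destruct (irrational_rotation_dense alpha ((t - t0) / (2 * PI)) (del / (2 * PI)) Ha) as (n & k & Hnk).
  { apply Rdiv_lt_0_compat; [apply cond_pos|exact P2]. }
  specialize (Hdel (t0 + INR n * (2 * PI * alpha) + 2 * PI * IZR k)).
  rewrite Hper, Horb in Hdel. apply Hdel.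
  unfold ball; simpl; unfold AbsRing_ball, abs, minus, plus, opp; simpl.
  replace (t0 + INR n * (2 * PI * alpha) + 2 * PI * IZR k + - t)
    with (2 * PI * (INR n * alpha + IZR k - (t - t0) / (2 * PI))) by (field; lra).
  rewrite Rabs_mult, (Rabs_pos_eq (2 * PI)) by lra.
  apply Rmult_lt_reg_r with (/ (2 * PI)); [now apply Rinv_0_lt_compat|].
  replace (2 * PI * Rabs (INR n * alpha + IZR k - (t - t0) / (2 * PI)) * / (2 * PI))
    with (Rabs (INR n * alpha + IZR k - (t - t0) / (2 * PI))) by (field; lra).
  exact Hnk. }
assert (P := PI_RGT_0).
assert (E : Gamma alpha 0 = Gamma alpha PI).
{ apply eq_is_derive; [|lra]. intros t _. rewrite <- (Hz t). apply Hf'. }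
destruct (Gamma_injective alpha H _ _ E) as [k Hk].
assert (E2 : PI * (1 + 2 * IZR k) = 0) by lra.
apply Rmult_integral in E2. destruct E2 as [E2|E2]; [lra|].
assert (E3 : IZR (1 + 2 * k) = 0) by (rewrite plus_IZR, mult_IZR; exact E2).
apply eq_IZR_R0 in E3. lia.
Qed.

(** * Homeomorphism onto the image *)

Lemma angle_representative t : exists s, 0 <= s <= 2 * PI /\ same_angle s t.
Proof.
assert (P := PI_RGT_0). set (k := Zfloor (t / (2 * PI))).
assert (B := Zfloor_bound (t / (2 * PI))). fold k in B.
exists (t - 2 * PI * IZR k).
assert (L1 := proj2 (Rle_div_r (IZR k) t (2 * PI) ltac:(lra)) (proj1 B)).
assert (L2 := proj1 (Rlt_div_l t (IZR k + 1) (2 * PI) ltac:(lra)) (proj2 B)).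
split; [lra|]. exists (- k)%Z. rewrite opp_IZR. ring.
Qed.

(** Compactness of the circle: a cover of [[0, 2 pi]] by open intervals that are either contained in [U]
    or mapped away from [p] bounds the distance from [p] to the image of the
    complement of [U]. *)
Lemma continuous_injective_homeomorphism (f : R -> C2) :
  (forall t, continuous f t) -> circle_map f -> circle_injective f ->
  homeomorphism_onto_image f.
Proof.
intros Hc Hm Hi. split; [exact Hm|]. split; [exact Hi|]. split.
{ intros V HV. split.
  - intros t Ht. exact (Hc t _ (HV _ Ht)).
  - intros s t E Hs. now rewrite <- (Hm _ _ E). }
intros U [HU HUs].
exists (fun p => locally p (fun q => forall t, f t = q -> U t)). split.
{ intros p Hp. now apply locally_locally. }
intros p. split.
2:{ intros [[t [_ Ht]] Hp]. exists t. split; [|exact Ht].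
  exact (locally_singleton _ _ Hp t Ht). }
intros [t0 [Ht0 Hp]]. split; [exists t0; now split|].
assert (Hdel : forall t, exists del : posreal,
  (forall x, Rabs (x - t) < del -> U x) \/
  (forall x, Rabs (x - t) < del -> ~ ball p del (f x))).
{ intros t. destruct (Classical_Prop.classic (U t)) as [Ut|Ut].
  - destruct (HU t Ut) as [del Hdel]. exists del. left. intros x Hx. now apply Hdel.
  - assert (Hne : f t <> p).
    { intros E. apply Ut. apply (HUs t0); [|exact Ht0]. apply Hi. congruence. }
    assert (Heps : exists eps : posreal, ~ ball (f t) eps p).
    { apply Classical_Pred_Type.not_all_ex_not. intros F. apply Hne. now apply eq_close. }
    destruct Heps as [eps Heps].
    destruct (proj1 (filterlim_locally _ _) (Hc t) (pos_div_2 eps)) as [del Hdel].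
    assert (Hmin : 0 < Rmin del (eps / 2)) by (apply Rmin_glb_lt; [apply cond_pos|apply (cond_pos (pos_div_2 eps))]).
    exists (mkposreal _ Hmin). right. simpl. intros x Hx B. apply Heps.
    rewrite <- (Rplus_half_diag eps).
    apply ball_triangle with (f x).
    + apply Hdel. apply Rlt_le_trans with (1 := Hx), Rmin_l.
    + apply ball_sym. apply ball_le with (2 := B). apply Rmin_r. }
destruct (choice _ Hdel) as [del Hdel']. clear Hdel.
destruct (compactness_value_1d 0 (2 * PI) del) as [r Hr].
exists r. intros q Hq t Ht.
destruct (angle_representative t) as [s [Hs Est]].
apply (HUs s t Est).
destruct (Classical_Prop.classic (U s)) as [Us|Us]; [exact Us|exfalso].
apply (Hr s Hs). intros (u & _ & Hsu & Hru).
destruct (Hdel' u) as [G|G].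
- apply Us, G, Hsu.
- apply (G s Hsu). rewrite (Hm _ _ Est), Ht. now apply ball_le with r.
Qed.

Theorem corollary1 :
  (forall alpha : R, bounded_type alpha -> class_C1 (Gamma alpha)) ->
  forall alpha : R, bounded_type alpha ->
    embedding (Gamma alpha) /\
    conjugates_rotation (Gamma alpha) (2 * PI * alpha) (dynamics alpha).
Proof.
intros HC alpha H. assert (HCa := HC alpha H).
assert (Hi := Gamma_injective alpha H). assert (Hm := Gamma_circle_map alpha).
split; [split; [exact Hm|split; [|exact Hi]]|split].
- now apply Gamma_immersion.
- apply continuous_injective_homeomorphism; auto. intros t.
  destruct HCa as [f' [Hf' _]]. apply (ex_derive_continuous (Gamma alpha)).
  exists (f' t). apply Hf'.
- intros t. now apply Gamma_conjugacy.
Qed.
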